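(* Let $\Sigma$ be a (bounded) smooth $k$-manifold without boundary embedded in $\mathbb{R}^d$, with $2 \le k < d$. Let $\tau$ be a triangle whose vertices lie on $\Sigma$. Let $R$ be the circumradius of $\tau$. Let $v$ be a vertex of $\tau$ and let $\phi$ be the plane angle of $\tau$ at $v$. Then, whenever the argument of the arcsine is at most $1$, $$\angle(N_\tau, N_v\Sigma) = \angle(\mathrm{aff}\,\tau, T_v\Sigma) \leq \arcsin\left( \frac{R}{\mathrm{ebs}(v)} \max\left\{ \cot\frac{\phi}{2}, 1 \right\} \right).$$
   Context: A bounded smooth manifold without boundary in $\mathbb{R}^d$ means a compact smoothly embedded submanifold without boundary. For $p \in \Sigma$, $T_p\Sigma$ is the tangent $k$-flat at $p$ and $N_p\Sigma$ is the $(d-k)$-flat through $p$ orthogonal to $T_p\Sigma$. The medial axis $M$ of $\Sigma$ is the closure of the set of points of $\mathbb{R}^d$ having more than one nearest point on $\Sigma$. The empty ball size is $\mathrm{ebs}(p) = \min_{m \in M \cap N_p\Sigma} |pm|$, equivalently the radius of the smallest medial ball tangent to $\Sigma$ at $p$ (a medial ball is an open ball centered on $M$, disjoint from $\Sigma$, whose boundary intersects $\Sigma$). For a triangle $\tau \subset \mathbb{R}^d$, $\mathrm{aff}\,\tau$ is its affine hull (a $2$-flat) and $N_\tau$ is the $(d-2)$-flat of points equidistant to the three vertices of $\tau$ (orthogonal to $\mathrm{aff}\,\tau$). The circumradius is the radius of the circle through the three vertices; the plane angle at $v$ is the usual interior angle of the triangle at $v$. For flats $F, G$ with $\dim F \le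 \dim G$, $\angle(F,G) = \angle(G,F) = \max_{\ell_F \subset F}\min_{\ell_G \subset G} \angle(\ell_F,\ell_G) \in [0^\circ, 90^\circ]$, where $\ell_F,\ell_G$ range over lines and $\angle(\ell_F,\ell_G)$ is the nonobtuse angle between their directions. *)

(* Defs.v *)
From HB Require Import structures.
From mathcomp Require Import all_boot all_order all_algebra.
From mathcomp Require Import all_classical all_reals all_analysis.

Set Implicit Arguments.
Unset Strict Implicit.
Unset Printing Implicit Defensive.

Import Order.TTheory GRing.Theory Num.Theory.
Import numFieldNormedType.Exports.

Local Open Scope classical_set_scope.
Local Open Scope ring_scope.

(* The library norm on 'rV[R]_d is the sup norm.  It induces the usual topology
   and differentiability, but metric notions need the Euclidean norm. *)
Section Euclid.
Context {R : realType} {d : nat}.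
Implicit Types (u w x y : 'rV[R]_d) (F G : set 'rV[R]_d).

Definition dotv u w : R := \sum_(i < d) u 0 i * w 0 i.

Definition enorm u : R := Num.sqrt (dotv u u).

Definition eucdist x y : R := enorm (x - y).

Definition vangle u w : R := acos (dotv u w / (enorm u * enorm w)).

Definition line_angle u w : R := acos (`|dotv u w| / (enorm u * enorm w)).

Definition line x u : set 'rV[R]_d := [set x + t *: u | t in [set: R]].

Definition line_dirs F : set 'rV[R]_d :=
  [set u | u != 0 /\ exists x, line x u `<=` F].

Definition is_flat (n : nat) F : Prop :=
  exists (V : {vspace 'rV[R]_d}) (p : 'rV[R]_d),
    \dim V = n /\ F = [set x | x - p \in V].

(* 0 when F is not a flat. *)
Definition flat_dim F : nat := xget 0%N [set n | is_flat n F].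

Definition maxmin_angle F G : R :=
  sup [set inf [set line_angle u w | w in line_dirs G] | u in line_dirs F].

Definition flat_angle F G : R :=
  if (flat_dim F <= flat_dim G)%N then maxmin_angle F G else maxmin_angle G F.

End Euclid.

Section Smooth.
Context {R : realType} {V W : normedModType R}.

(* For A open and V finite-dimensional this is the usual C^n: differentiable on
   A with all directional derivatives of class C^(n-1). *)
Fixpoint Ck_on (n : nat) (A : set V) (f : V -> W) : Prop :=
  if n is m.+1 then
    (forall x, A x -> differentiable f x) /\
    (forall v, Ck_on m A ('D_v f))
  else forall x, A x -> {for x, continuous f}.

Definition smooth_on (A : set V) (f : V -> W) : Prop := forall n, Ck_on n A f.

End Smooth.

Section Manifold.
Context {R : realType} {d : nat}.
Implicit Types (S U V : set 'rV[R]_d) (f g : 'rV[R]_d -> 'rV[R]_d)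
  (p x m : 'rV[R]_d).

Definition diffeo_on U V f g : Prop :=
  [/\ smooth_on U f, smooth_on V g,
      forall x, U x -> V (f x) /\ g (f x) = x &
      forall y, V y -> U (g y) /\ f (g y) = y].

(* Slice charts: near each of its points S is straightened by an ambient
   diffeomorphism to R^k x {0}; the coordinates of index >= k are those that
   vanish. *)
Definition smooth_submanifold (k : nat) S : Prop :=
  forall p, S p -> exists U V f g,
    [/\ open U, open V, U p, diffeo_on U V f g &
        forall x, U x -> (S x <-> forall i : 'I_d, (k <= i)%N -> f x 0 i = 0)].

Definition tangent_vec S p : set 'rV[R]_d :=
  [set u | exists c : R -> 'rV[R]_d,
    [/\ c 0 = p, \forall t \near (0 : R), S (c t) & is_derive (0 : R) 1 c u]].

Definition tangent_flat S p : set 'rV[R]_d :=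
  [set p + u | u in tangent_vec S p].

Definition normal_flat S p : set 'rV[R]_d :=
  [set x | forall u, tangent_vec S p u -> dotv (x - p) u = 0].

Definition nearest S x : set 'rV[R]_d :=
  [set q | S q /\ forall y, S y -> eucdist x q <= eucdist x y].

Definition medial_axis S : set 'rV[R]_d :=
  closure [set x | exists q1 q2, [/\ q1 != q2, nearest S x q1 & nearest S x q2]].

(* The set of distances is closed, so its infimum is a minimum unless it is
   empty, in which case the value is +oo. *)
Definition ebs S p : \bar R :=
  ereal_inf [set (eucdist p m)%:E | m in medial_axis S `&` normal_flat S p].

End Manifold.

Section Triangle.
Context {R : realType} {d : nat}.
Implicit Types (tau : 'I_3 -> 'rV[R]_d) (i : 'I_3).

(* tau lists the vertices, which are required to be affinely independent. *)
Definition triangle tau : Prop :=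
  forall a : 'I_3 -> R, \sum_j a j = 0 -> \sum_j a j *: tau j = 0 ->
    forall j, a j = 0.

Definition aff_hull tau : set 'rV[R]_d :=
  [set \sum_j a j *: tau j | a in [set a : 'I_3 -> R | \sum_j a j = 1]].

Definition equidistant_flat tau : set 'rV[R]_d :=
  [set x | forall i j, eucdist x (tau i) = eucdist x (tau j)].

(* For a nondegenerate triangle the circumcenter is the unique point of this
   intersection. *)
Definition circumcenter tau : 'rV[R]_d :=
  xget 0 (aff_hull tau `&` equidistant_flat tau).

Definition circumradius tau : R := eucdist (circumcenter tau) (tau ord0).

(* Indices in 'I_3 are added modulo 3: i + 1 and i - 1 are the other two. *)
Definition plane_angle tau i : R :=
  vangle (tau (i + 1) - tau i) (tau (i - 1) - tau i).

End Triangle.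

Definition cot {R : realType} (x : R) : R := cos x / sin x.

(* Extended-real division is used, with 0^-1 = +oo and +oo^-1 = 0: a vanishing
   ebs makes the argument infinite rather than 0. *)
Definition arcsin_arg {R : realType} {d : nat} (S : set 'rV[R]_d)
    (tau : 'I_3 -> 'rV[R]_d) (i : 'I_3) : \bar R :=
  ((circumradius tau)%:E / ebs S (tau i)
   * (Num.max (cot (plane_angle tau i / 2)) 1)%:E)%E.

(* Main.v *)
Require Import Defs.
From HB Require Import structures.
From mathcomp Require Import all_boot all_order all_algebra.
From mathcomp Require Import all_classical all_reals all_analysis.
From mathcomp Require Import ring lra.

Set Implicit Arguments.
Unset Strict Implicit.
Unset Printing Implicit Defensive.

Import Order.TTheory GRing.Theory Num.Theory.
Import numFieldNormedType.Exports.

Local Open Scope classical_set_scope.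
Local Open Scope ring_scope.

(** If [v] is nearest to [v + t n] for a unit normal [n], then
    [2 t <y - v, n> <= |y - v|^2] for all [y] in Sigma.  This holds for all
    [t < ebs v]: otherwise consider the last good center [c = v + s n].  If [c]
    is off the medial axis, nearest points are unique, hence depend
    continuously on the center, around [c]; then the distance to Sigma grows
    at unit speed away from the nearest point, and a maximizer of the distance
    on a small ball around [c] is a good center beyond [c].

    Applied to both edges of the triangle at [v] and to [n], [-n], this bounds
    the normal component of a unit vector of the plane of tau by
    [(|s| A + |t| B) / (2 ebs v)], where [A], [B] are the edge lengths and
    [s], [t] the coordinates on the unit edge vectors.  Maximizing over
    [s^2 + t^2 + 2 s t cos phi = 1] yields [R / ebs v * max (cot (phi/2)) 1].

    The angle equality is duality: the cosine of the max-min angle of [(U, V)]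
    is the best [s] with [s |u| <= |P_V u|] on [U], and that [s] is shared by
    [(V^perp, U^perp)], and also by [(V, U)] when the dimensions agree. *)

(** * Euclidean geometry of row vectors *)

Section EuclideanSpace.
Context {R : realType} {d : nat}.
Implicit Types (u w x y z : 'rV[R]_d) (a : R).

Lemma dotvC u w : dotv u w = dotv w u.
Proof. by apply: eq_bigr => i _; rewrite mulrC. Qed.

Lemma dotvDl u w x : dotv (u + w) x = dotv u x + dotv w x.
Proof. by rewrite -big_split; apply: eq_bigr => i _; rewrite mxE mulrDl. Qed.

Lemma dotvZl a u x : dotv (a *: u) x = a * dotv u x.
Proof. by rewrite mulr_sumr; apply: eq_bigr => i _; rewrite mxE mulrA. Qed.

Lemma dotvNl u x : dotv (- u) x = - dotv u x.
Proof. by rewrite -scaleN1r dotvZl mulN1r. Qed.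

Lemma dotvBl u w x : dotv (u - w) x = dotv u x - dotv w x.
Proof. by rewrite dotvDl dotvNl. Qed.

Lemma dotvDr u w x : dotv x (u + w) = dotv x u + dotv x w.
Proof. by rewrite dotvC dotvDl !(dotvC _ x). Qed.

Lemma dotvZr a u x : dotv x (a *: u) = a * dotv x u.
Proof. by rewrite dotvC dotvZl dotvC. Qed.

Lemma dotvNr u x : dotv x (- u) = - dotv x u.
Proof. by rewrite dotvC dotvNl dotvC. Qed.

Lemma dotvBr u w x : dotv x (u - w) = dotv x u - dotv x w.
Proof. by rewrite dotvDr dotvNr. Qed.

Lemma dotv0l x : dotv 0 x = 0.
Proof. by rewrite -(scale0r x) dotvZl mul0r. Qed.

Lemma dotv0r x : dotv x 0 = 0.
Proof. by rewrite dotvC dotv0l. Qed.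

Lemma dotv_suml (I : Type) (r : seq I) (P : pred I) (F : I -> 'rV[R]_d) x :
  dotv (\sum_(i <- r | P i) F i) x = \sum_(i <- r | P i) dotv (F i) x.
Proof.
by apply: (big_morph (fun u => dotv u x) (fun u w => dotvDl u w x) (dotv0l x)).
Qed.

Definition dotvE := (dotvDl, dotvDr, dotvZl, dotvZr, dotvNl, dotvNr).

Lemma dotv_ge0 u : 0 <= dotv u u.
Proof. by apply: sumr_ge0 => i _; rewrite -expr2 sqr_ge0. Qed.

Lemma dotv_eq0 u : (dotv u u == 0) = (u == 0).
Proof.
apply/eqP/eqP => [|->]; last by rewrite dotv0l.
move=> /eqP; rewrite psumr_eq0 => [/allP h|i _]; last by rewrite -expr2 sqr_ge0.
apply/rowP => i; rewrite mxE; apply/eqP.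
by have := h i (mem_index_enum i); rewrite /= -expr2 sqrf_eq0.
Qed.

Lemma dotv_gt0 u : (0 < dotv u u) = (u != 0).
Proof. by rewrite lt_def dotv_eq0 dotv_ge0 andbT. Qed.

Lemma enorm_ge0 u : 0 <= enorm u.
Proof. exact: sqrtr_ge0. Qed.

Lemma sqr_enorm u : enorm u ^+ 2 = dotv u u.
Proof. by rewrite sqr_sqrtr // dotv_ge0. Qed.

Lemma enorm_eq0 u : (enorm u == 0) = (u == 0).
Proof. by rewrite -sqrf_eq0 sqr_enorm dotv_eq0. Qed.

Lemma enorm_gt0 u : (0 < enorm u) = (u != 0).
Proof. by rewrite lt_def enorm_eq0 enorm_ge0 andbT. Qed.

Lemma enorm0 : enorm (0 : 'rV[R]_d) = 0.
Proof. by apply/eqP; rewrite enorm_eq0. Qed.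

Lemma enormZ a u : enorm (a *: u) = `|a| * enorm u.
Proof.
by rewrite /enorm !dotvE mulrA -expr2 sqrtrM ?sqr_ge0 // sqrtr_sqr.
Qed.

Lemma enormN u : enorm (- u) = enorm u.
Proof. by rewrite -scaleN1r enormZ normrN1 mul1r. Qed.

Lemma enormB u w : enorm (u - w) = enorm (w - u).
Proof. by rewrite -enormN opprB. Qed.

(** The squared length of [dotv w w *: u - dotv u w *: w] is [dotv w w] times the difference of the
    two sides. *)
Lemma dotv_sqr_le u w : dotv u w ^+ 2 <= dotv u u * dotv w w.
Proof.
have [->|w0] := eqVneq w 0; first by rewrite !dotv0r expr0n mulr0.
have ww : 0 < dotv w w by rewrite dotv_gt0.
have := dotv_ge0 (dotv w w *: u - dotv u w *: w).
rewrite !dotvE (dotvC w u) => h.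
rewrite -subr_ge0 -(pmulr_rge0 _ ww).
by move: h; congr (0 <= _); ring.
Qed.

Lemma dotv_norm_le u w : `|dotv u w| <= enorm u * enorm w.
Proof.
rewrite -(@ler_pXn2r _ 2) ?nnegrE ?mulr_ge0 ?enorm_ge0 //.
by rewrite real_normK ?num_real // exprMn !sqr_enorm dotv_sqr_le.
Qed.

Lemma dotv_le u w : dotv u w <= enorm u * enorm w.
Proof. exact: le_trans (ler_norm _) (dotv_norm_le u w). Qed.

Lemma enormD u w : enorm (u + w) <= enorm u + enorm w.
Proof.
rewrite -(@ler_pXn2r _ 2) ?nnegrE ?addr_ge0 ?enorm_ge0 //.
rewrite sqr_enorm sqrrD !sqr_enorm !dotvE (dotvC w u).
by have := dotv_le u w; lra.
Qed.

Lemma enorm_triangle x y z : enorm (x - z) <= enorm (x - y) + enorm (y - z).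
Proof. by rewrite -[x - z](subrKA y) enormD. Qed.

(** With [enorm_le_mxnorm], this lets topology and differentials, which are stated in the sup norm,
    be handled with [enorm]; the constants do not matter. *)
Lemma mxnorm_le_enorm u : `|u| <= enorm u.
Proof.
have [->|u0] := eqVneq u 0; first by rewrite normr0 enorm0.
have [[i j] /= ->] : exists ij, `|u| = `|u ij.1 ij.2|.
  by apply: mx_norm_neq0; apply: contra u0 => /eqP/mx_norm_eq0/eqP.
rewrite -(@ler_pXn2r _ 2) ?nnegrE ?enorm_ge0 //.
rewrite real_normK ?num_real // sqr_enorm /dotv (bigD1 j) //= ord1 -expr2.
by rewrite lerDl sumr_ge0 // => l _; rewrite -expr2 sqr_ge0.
Qed.

Lemma enorm_le_mxnorm u : enorm u <= d%:R * `|u|.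
Proof.
rewrite -(@ler_pXn2r _ 2) ?nnegrE ?enorm_ge0 ?mulr_ge0 // sqr_enorm.
rewrite exprMn -natrX.
have le1 i : u 0 i * u 0 i <= `|u| ^+ 2.
  rewrite -expr2 -real_normK ?num_real // ler_pXn2r ?nnegrE //.
  rewrite {2}/Num.norm /= mx_normrE.
  exact: (le_bigmax _ (fun ij : 'I_1 * 'I_d => `|u ij.1 ij.2|) (0, i)).
rewrite (le_trans (ler_sum _ (fun i _ => le1 i))) // sumr_const card_ord.
rewrite -[leLHS]mulr_natl ler_wpM2r ?sqr_ge0 // ler_nat.
by case: (d) => // n; rewrite expnS leq_pmulr // expn_gt0.
Qed.

End EuclideanSpace.

(** * Orthogonal complements and orthogonal projections *)

Section OrthogonalComplement.
Context {R : realType} {d : nat}.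
Implicit Types (u w x y z : 'rV[R]_d) (U V : {vspace 'rV[R]_d}).

(** Makes the orthogonal complement the kernel of a linear map, hence a [{vspace}] to which
    rank-nullity applies. *)
Definition dot_basis V x : 'rV[R]_(\dim V) :=
  \row_j dotv x (vbasis V)`_j.

Lemma dot_basis_is_linear V : linear (dot_basis V).
Proof. by move=> a x y; apply/rowP => j; rewrite !mxE !dotvE. Qed.

HB.instance Definition _ V := GRing.isLinear.Build R 'rV[R]_d
  'rV[R]_(\dim V) _ (dot_basis V) (dot_basis_is_linear V).

Definition orthov V : {vspace 'rV[R]_d} := lker (linfun (dot_basis V)).

Lemma mem_orthovP V x :
  reflect (forall v, v \in V -> dotv x v = 0) (x \in orthov V).
Proof.
rewrite memv_ker lfunE /=; apply: (iffP eqP) => [x0 v vV|x0]; last first.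
  apply/rowP => j; rewrite !mxE x0 // vbasis_mem // mem_nth //.
  by rewrite size_tuple.
rewrite (coord_vbasis vV) dotvC dotv_suml big1 // => j _.
have /rowP/(_ j) := x0; rewrite !mxE dotvZl dotvC => ->.
by rewrite mulr0.
Qed.

Lemma orthov_cap V : (V :&: orthov V = 0)%VS.
Proof.
apply/eqP; rewrite -subv0; apply/subvP => x; rewrite memv_cap memv0.
by move=> /andP[xV /mem_orthovP/(_ x xV)/eqP]; rewrite dotv_eq0.
Qed.

(** Rank-nullity gives the lower bound, since the image has dimension at most [\dim V]; the trivial
    intersection with [V] gives the upper one. *)
Lemma dim_orthov V : \dim (orthov V) = (d - \dim V)%N.
Proof.
have dimE : \dim {:'rV[R]_d} = d by rewrite dimvf /dim /= mul1n.
have := limg_ker_dim (linfun (dot_basis V)) fullv.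
rewrite capfv dimE -/(orthov V) => ker_dim.
have img_dim : (\dim (linfun (dot_basis V) @: fullv) <= \dim V)%N.
  by rewrite (leq_trans (dimvS (subvf _))) // dimvf /dim /= mul1n.
have : (\dim (V + orthov V) <= d)%N by rewrite -[leqRHS]dimE dimvS // subvf.
rewrite dimv_disjoint_sum ?orthov_cap // => sum_dim.
apply/eqP; rewrite eqn_leq; apply/andP; split.
  by rewrite -[leqLHS](addKn (\dim V)) leq_sub2r.
by rewrite leq_subLR -[leqLHS]ker_dim addnC leq_add2r.
Qed.

Lemma orthov_add V : (V + orthov V)%VS = fullv.
Proof.
have dimE : \dim {:'rV[R]_d} = d by rewrite dimvf /dim /= mul1n.
apply/eqP; rewrite eqEdim subvf /= dimv_disjoint_sum ?orthov_cap //.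
have : (\dim V <= d)%N by rewrite -[leqRHS]dimE dimvS // subvf.
by rewrite dim_orthov dimE => h; rewrite subnKC.
Qed.

Lemma orthovK V : orthov (orthov V) = V.
Proof.
have dimE : \dim {:'rV[R]_d} = d by rewrite dimvf /dim /= mul1n.
have : (\dim V <= d)%N by rewrite -[leqRHS]dimE dimvS // subvf.
move=> dV; apply/esym/eqP; rewrite eqEdim !dim_orthov subKn // leqnn andbT.
apply/subvP => v vV; apply/mem_orthovP => w /mem_orthovP/(_ v vV).
by rewrite dotvC.
Qed.

Lemma oproj_exists V x : exists p, p \in V /\ x - p \in orthov V.
Proof.
have : x \in (V + orthov V)%VS by rewrite orthov_add memvf.
by move=> /memv_addP[p pV [q qV ->]]; exists p; rewrite addrC addKr.
Qed.

Definition oproj V x : 'rV[R]_d := xget 0 [set p | p \in V /\ x - p \in orthov V].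

Lemma oprojP V x : oproj V x \in V /\ x - oproj V x \in orthov V.
Proof. exact: (xgetPex 0 (oproj_exists V x)). Qed.

Lemma oproj_mem V x : oproj V x \in V.
Proof. by case: (oprojP V x). Qed.

Lemma dotv_oproj V x v : v \in V -> dotv (oproj V x) v = dotv x v.
Proof.
case: (oprojP V x) => _ /mem_orthovP h /h.
by rewrite dotvBl => /eqP; rewrite subr_eq0 => /eqP.
Qed.

Lemma dotv_oprojr V x : dotv x (oproj V x) = dotv (oproj V x) (oproj V x).
Proof. by rewrite (dotv_oproj x (oproj_mem V x)). Qed.

Lemma pythagoras V x :
  dotv x x = dotv (oproj V x) (oproj V x) + dotv (x - oproj V x) (x - oproj V x).
Proof. by rewrite !dotvE (dotvC (oproj V x) x) !dotv_oprojr; lra. Qed.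

Lemma oproj_unique V x p : p \in V -> x - p \in orthov V -> oproj V x = p.
Proof.
move=> pV pO; have [qV qO] := oprojP V x.
have : oproj V x - p \in (V :&: orthov V)%VS.
  rewrite memv_cap rpredB //=.
  suff -> : oproj V x - p = (x - p) - (x - oproj V x) by rewrite rpredB.
  by rewrite opprB [RHS]addrC addrA subrK.
by rewrite orthov_cap memv0 subr_eq0 => /eqP.
Qed.

Lemma oproj_is_linear V : linear (oproj V).
Proof.
move=> a x y; have [px ox] := oprojP V x; have [py oy] := oprojP V y.
apply: oproj_unique; first by rewrite rpredD // rpredZ.
by rewrite opprD addrACA -scalerBr rpredD // rpredZ.
Qed.

HB.instance Definition _ V := GRing.isLinear.Build R 'rV[R]_d 'rV[R]_d _
  (oproj V) (oproj_is_linear V).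

Lemma oproj_orthov V x : oproj (orthov V) x = x - oproj V x.
Proof.
have [pV pO] := oprojP V x.
by apply: oproj_unique => //; rewrite opprB addrCA subrr addr0 orthovK.
Qed.

Lemma enorm_oproj_le V x : enorm (oproj V x) <= enorm x.
Proof.
rewrite /enorm ler_sqrt ?dotv_ge0 // (pythagoras V x).
by rewrite lerDl dotv_ge0.
Qed.

End OrthogonalComplement.

(** * Angles between flats *)

Section Acos.
Context {R : realType}.
Implicit Types (x y : R).

Lemma acos_le x y : -1 <= x -> x <= y -> y <= 1 -> acos y <= acos x.
Proof.
move=> x1 xy y1.
have xI : -1 <= x <= 1 by rewrite x1 (le_trans xy).
have yI : -1 <= y <= 1 by rewrite y1 (le_trans x1).
have [/andP[x0 xpi] cx] := acos_def xI; have [/andP[y0 ypi] cy] := acos_def yI.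
rewrite leNgt; apply/negP => lt.
have : cos (acos y) < cos (acos x) by rewrite ltr_cos // in_itv /= ?x0 ?y0.
by rewrite cx cy ltNge xy.
Qed.

Lemma acos_le_inv x y : -1 <= x <= 1 -> -1 <= y <= 1 ->
  acos y <= acos x -> x <= y.
Proof.
move=> xI yI.
have [/andP[x0 xpi] cx] := acos_def xI; have [/andP[y0 ypi] cy] := acos_def yI.
rewrite leNgt => /negP lt; rewrite leNgt; apply/negP => yx; apply: lt.
by rewrite -ltr_cos ?cx ?cy // in_itv /= ?x0 ?y0.
Qed.

(** [cosK] applies because [asin x] lies in [[0, pi]]: a negative value would have a negative
    sine. *)
Lemma acos_sqrt x : 0 <= x <= 1 -> acos (Num.sqrt (1 - x ^+ 2)) = asin x.
Proof.
move=> /andP[x0 x1]; have xI : -1 <= x <= 1 by rewrite x1 (le_trans _ x0) ?lerN10.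
rewrite -cos_asin // cosK // in_itv /=.
have [/andP[_ api] sx] := asin_def xI.
apply/andP; split; last by apply: (le_trans api); have := @pi_ge0 R; lra.
rewrite leNgt; apply/negP => a0; move: x0; rewrite -sx leNgt => /negP; apply.
rewrite -oppr_gt0 -sinN sin_gt0_pi // oppr_gt0 a0 /=.
by have := asin_geNpi2 xI; have := @pi_gt0 R; lra.
Qed.

End Acos.

(** * Max-min angles in terms of orthogonal projections *)

Section FlatAngle.
Context {R : realType} {d : nat}.
Implicit Types (u w p q x : 'rV[R]_d) (U V W : {vspace 'rV[R]_d}) (s : R).

(** Common form to which the four flats of the theorem are reduced. *)
Definition vflat p V : set 'rV[R]_d := [set x | x - p \in V].

Lemma vflat_dir p q V W : vflat p V = vflat q W -> (V <= W)%VS.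
Proof.
move=> e; apply/subvP => u uV.
have pW : vflat q W p by rewrite -e /vflat /= subrr mem0v.
have puW : vflat q W (p + u) by rewrite -e /vflat /= addrAC subrr add0r.
suff -> : u = (p + u - q) - (p - q) by apply: rpredB.
by rewrite opprB addrA subrK addrAC subrr add0r.
Qed.

Lemma flat_dim_vflat p V : flat_dim (vflat p V) = \dim V.
Proof.
apply: xget_unique; first by exists V, p.
move=> n [W [q [<- e]]]; congr (\dim _); apply/eqP.
by rewrite eqEsubv (vflat_dir e) (vflat_dir (esym e)).
Qed.

Lemma line_dirs_vflat p V :
  line_dirs (vflat p V) = [set u | u != 0 /\ u \in V].
Proof.
apply/seteqP; split=> u /= [u0].
  move=> [x xV]; split => //.
  have x0 : vflat p V x by apply: xV; exists 0; rewrite ?scale0r ?addr0.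
  have x1 : vflat p V (x + u) by apply: xV; exists 1; rewrite ?scale1r.
  suff -> : u = (x + u - p) - (x - p) by apply: rpredB.
  by rewrite opprB addrA subrK addrAC subrr add0r.
move=> uV; split => //; exists p => _ [t _ <-].
by rewrite /vflat /= addrAC subrr add0r rpredZ.
Qed.

Lemma cos_proj_itv W u : 0 <= enorm (oproj W u) / enorm u <= 1.
Proof.
rewrite divr_ge0 ?enorm_ge0 //=.
have [->|u0] := eqVneq u 0; first by rewrite enorm0 invr0 mulr0.
by rewrite ler_pdivrMr ?enorm_gt0 // mul1r enorm_oproj_le.
Qed.

Lemma cos_line_itv u w : 0 <= `|dotv u w| / (enorm u * enorm w) <= 1.
Proof.
rewrite divr_ge0 ?mulr_ge0 ?enorm_ge0 //=.
have [->|u0] := eqVneq u 0; first by rewrite enorm0 mul0r invr0 mulr0.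
have [->|w0] := eqVneq w 0; first by rewrite enorm0 mulr0 invr0 mulr0.
by rewrite ler_pdivrMr ?mulr_gt0 ?enorm_gt0 // mul1r dotv_norm_le.
Qed.

(** For [w] in [W] the product [dotv u w] sees only the projection of [u], so Cauchy-Schwarz gives
    the lower bound; it is attained at the projection itself. *)
Lemma inf_line_angle q W u : W != 0%VS -> u != 0 ->
  inf [set line_angle u w | w in line_dirs (vflat q W)] =
  acos (enorm (oproj W u) / enorm u).
Proof.
move=> W0 u0; rewrite line_dirs_vflat.
have /andP[_ p1] := cos_proj_itv W u.
have lb : lbound [set line_angle u w | w in [set w | w != 0 /\ w \in W]]
    (acos (enorm (oproj W u) / enorm u)).
  move=> _ [w [w0 wW] <-]; rewrite /line_angle.
  have /andP[l0 l1] := cos_line_itv u w.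
  apply: acos_le => //; first by rewrite (le_trans _ l0) ?lerN10.
  rewrite invfM mulrA mulrAC ler_wpM2r ?invr_ge0 ?enorm_ge0 //.
  rewrite ler_pdivrMr ?enorm_gt0 // -(dotv_oproj u wW).
  exact: dotv_norm_le.
have [z [zW zE]] : exists z, (z != 0 /\ z \in W) /\
    line_angle u z = acos (enorm (oproj W u) / enorm u).
  (* A zero projection spans no line, but then every line of [W] is at a right angle to [u]. *)
  have [pu0|pu0] := eqVneq (oproj W u) 0.
    exists (vpick W); rewrite vpick0 W0 memv_pick; split => //.
    rewrite /line_angle -(dotv_oproj u (memv_pick W)) pu0 enorm0 dotv0l.
    by rewrite normr0 !mul0r.
  exists (oproj W u); rewrite oproj_mem; split => //.
  rewrite /line_angle dotv_oprojr -sqr_enorm ger0_norm ?sqr_ge0 //.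
  by congr acos; field; rewrite !enorm_eq0 pu0 u0.
apply/eqP; rewrite eq_le; apply/andP; split; last first.
  by apply: lb_le_inf => //; exists (line_angle u z), z.
rewrite -zE; apply: ge_inf; last by exists z.
by exists (acos (enorm (oproj W u) / enorm u)).
Qed.

(** As [acos] decreases, the angle of [u] with [W] is at most [acos s] exactly when the projection
    inequality holds at [u]. The angles are bounded by [pi], so [sup] is a true supremum. *)
Lemma maxmin_angleP p q V W s : V != 0%VS -> W != 0%VS -> 0 <= s <= 1 ->
  maxmin_angle (vflat p V) (vflat q W) <= acos s <->
  (forall u, u \in V -> s * enorm u <= enorm (oproj W u)).
Proof.
move=> V0 W0 /andP[s0 s1].
have sI : -1 <= s <= 1 by rewrite s1 (le_trans _ s0) ?lerN10.
have projI u : -1 <= enorm (oproj W u) / enorm u <= 1.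
  by have /andP[h ->] := cos_proj_itv W u; rewrite (le_trans _ h) ?lerN10.
rewrite /maxmin_angle [in line_dirs (vflat p V)]line_dirs_vflat; split.
  move=> h u uV; have [->|u0] := eqVneq u 0; first by rewrite enorm0 mulr0 enorm_ge0.
  rewrite -ler_pdivlMr ?enorm_gt0 //.
  apply: acos_le_inv => //; apply: le_trans h.
  rewrite -(inf_line_angle q W0 u0); apply: ub_le_sup; last by exists u.
  exists pi => _ [w [w0 wV] <-]; rewrite inf_line_angle //.
  exact: acos_lepi.
move=> h; apply: ge_sup.
  exists (inf [set line_angle (vpick V) w | w in line_dirs (vflat q W)]).
  by exists (vpick V) => //; rewrite /= vpick0 V0 memv_pick.
move=> _ [u [u0 uV] <-]; rewrite inf_line_angle //.
apply: acos_le; first by case/andP: sI.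
  by rewrite ler_pdivlMr ?enorm_gt0 // h.
by case/andP: (projI u).
Qed.

Lemma maxmin_angle_cos p q V W : V != 0%VS -> W != 0%VS ->
  exists2 s, 0 <= s <= 1 & maxmin_angle (vflat p V) (vflat q W) = acos s.
Proof.
move=> V0 W0; set a := maxmin_angle _ _.
have a_ge0 : 0 <= a.
  have vV : vpick V != 0 /\ vpick V \in V by rewrite vpick0 V0 memv_pick.
  rewrite /a /maxmin_angle [in line_dirs (vflat p V)]line_dirs_vflat.
  have := cos_proj_itv W (vpick V) => /andP[c0 c1].
  apply: (@le_trans _ _ (acos (enorm (oproj W (vpick V)) / enorm (vpick V)))).
    by rewrite acos_ge0 // c1 (le_trans _ c0) ?lerN10.
  rewrite -(inf_line_angle q W0 vV.1); apply: ub_le_sup; last by exists (vpick V).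
  exists pi => _ [w [w0 wV] <-]; rewrite inf_line_angle //.
  have := cos_proj_itv W w => /andP[{}c0 {}c1].
  by rewrite acos_lepi // c1 (le_trans _ c0) ?lerN10.
have a_le : a <= pi / 2.
  (* The criterion at [s = 0] holds trivially. *)
  rewrite -acos0; apply/maxmin_angleP; rewrite ?lexx ?ler01 // => u _.
  by rewrite mul0r enorm_ge0.
have pi0 := @pi_ge0 R.
exists (cos a); last by rewrite cosK // in_itv /= a_ge0; lra.
by rewrite cos_le1 cos_ge0_pihalf // a_le andbT; lra.
Qed.

Lemma maxmin_angle_le p q p' q' U V U' V' :
  U != 0%VS -> V != 0%VS -> U' != 0%VS -> V' != 0%VS ->
  (forall s, 0 <= s <= 1 ->
    (forall u, u \in U -> s * enorm u <= enorm (oproj V u)) ->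
    (forall u, u \in U' -> s * enorm u <= enorm (oproj V' u))) ->
  maxmin_angle (vflat p' U') (vflat q' V') <= maxmin_angle (vflat p U) (vflat q V).
Proof.
move=> U0 V0 U0' V0' h.
have [s sI sE] := maxmin_angle_cos p q U0 V0.
rewrite sE; apply/maxmin_angleP => //; apply: h => //.
by apply/(maxmin_angleP p q U0 V0 sI); rewrite sE.
Qed.

(** Let [u] be the projection of [w] on [U] and [z] the part of [u] orthogonal to [V]. Since [w] is
    orthogonal to [V], [|u|^2 = <z, w>]. Cauchy-Schwarz and [|z|^2 <= (1 - s^2) |u|^2] give
    [|u|^2 <= (1 - s^2) |w|^2], and Pythagoras leaves at least [s^2 |w|^2] for [w - u]. *)
Lemma proj_bound_orthov U V s : 0 <= s <= 1 ->
  (forall u, u \in U -> s * enorm u <= enorm (oproj V u)) ->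
  forall w, w \in orthov V -> s * enorm w <= enorm (oproj (orthov U) w).
Proof.
move=> /andP[s0 s1] h w wV; rewrite oproj_orthov.
set u := oproj U w; set z : 'rV[R]_d := u - oproj V u.
have uU : u \in U by exact: oproj_mem.
have hu : s ^+ 2 * dotv u u <= dotv (oproj V u) (oproj V u).
  rewrite -!sqr_enorm -exprMn ler_pXn2r ?nnegrE ?mulr_ge0 ?enorm_ge0 //.
  exact: h.
have uw : dotv u u = dotv z w.
  have /mem_orthovP/(_ _ (oproj_mem V u)) wp := wV.
  by rewrite /z dotvBl (dotvC (oproj V u)) wp subr0 (dotvC u w) dotv_oprojr.
have cs : dotv u u ^+ 2 <= dotv z z * dotv w w by rewrite {1}uw dotv_sqr_le.
have zz := pythagoras V u; have ww := pythagoras U w.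
rewrite -/u in ww; rewrite -/z in zz.
rewrite -(@ler_pXn2r _ 2) ?nnegrE ?mulr_ge0 ?enorm_ge0 //.
rewrite exprMn !sqr_enorm.
have uu0 := dotv_ge0 u; have ww0 := dotv_ge0 w.
have : dotv u u * dotv u u <= dotv u u * ((1 - s ^+ 2) * dotv w w).
  rewrite -expr2 (le_trans cs) // mulrA ler_wpM2r //.
  rewrite mulrBr mulr1 lerBrDr [leRHS]zz addrC lerD2r mulrC.
  exact: hu.
have [u0 _|u0] := eqVneq (dotv u u) 0; last first.
  rewrite ler_pM2l ?lt_def ?u0 // => le_u.
  rewrite -(lerD2l (dotv u u)) -ww.
  by move: le_u; rewrite mulrBl mul1r lerBrDr.
by rewrite u0 add0r in ww; rewrite -ww ler_piMl // expr_le1.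
Qed.

Lemma maxmin_angle_orthov p q p' q' U V :
  U != 0%VS -> V != 0%VS -> orthov U != 0%VS -> orthov V != 0%VS ->
  maxmin_angle (vflat p' (orthov V)) (vflat q' (orthov U)) =
  maxmin_angle (vflat p U) (vflat q V).
Proof.
move=> U0 V0 U0' V0'; apply/eqP; rewrite eq_le; apply/andP; split.
  apply: maxmin_angle_le => // s sI h; exact: proj_bound_orthov.
apply: maxmin_angle_le => // s sI h u.
by have := proj_bound_orthov sI h (w := u); rewrite !orthovK.
Qed.

(** For [s > 0] the projection of [U] to [V] is injective, hence onto by equality of dimensions. If
    [w] is the projection of [u], then [|w|^2 = <u, w> <= |P_U w| |u|], while [s |u| <= |w|]. *)
Lemma maxmin_angle_swap_le p q p' q' U V : U != 0%VS -> \dim U = \dim V ->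
  maxmin_angle (vflat p' V) (vflat q' U) <= maxmin_angle (vflat p U) (vflat q V).
Proof.
move=> U0 dimE; have V0 : V != 0%VS by rewrite -dimv_eq0 -dimE dimv_eq0.
apply: maxmin_angle_le => // s /andP[s0 s1] h w wV.
have [->|sn0] := eqVneq s 0; first by rewrite mul0r enorm_ge0.
have [->|w0] := eqVneq w 0; first by rewrite enorm0 mulr0 enorm_ge0.
have [u uU wE] : exists2 u, u \in U & w = oproj V u.
  have kerP : (U :&: lker (linfun (oproj V)) = 0)%VS.
    apply/eqP; rewrite -subv0; apply/subvP => u.
    rewrite memv_cap memv_ker lfunE /= memv0 => /andP[/h hu /eqP pu].
    move: hu; rewrite pu enorm0 -enorm_eq0 pmulr_rle0 ?lt_def ?sn0 //.
    by move=> hu; rewrite eq_le hu enorm_ge0.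
  have imgE : (linfun (oproj V) @: U = V)%VS.
    apply/eqP; rewrite eqEdim (limg_dim_eq kerP) dimE leqnn andbT.
    by apply/subvP => _ /memv_imgP[u uU ->]; rewrite lfunE oproj_mem.
  by move: wV; rewrite -{1}imgE => /memv_imgP[u uU ->]; exists u; rewrite ?lfunE.
have uw : dotv u w = dotv w w by rewrite -(dotv_oproj u wV) -wE.
have hu := h u uU; rewrite -wE in hu.
have pu : enorm w ^+ 2 <= enorm (oproj U w) * enorm u.
  by rewrite sqr_enorm -uw dotvC -(dotv_oproj w uU) dotv_le.
have wpos : 0 < enorm w by rewrite enorm_gt0.
have upos : 0 < enorm u by rewrite (lt_le_trans wpos) // wE enorm_oproj_le.
rewrite -(ler_pM2r upos); apply: le_trans pu.
by rewrite mulrAC expr2 ler_wpM2r // ltW.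
Qed.

Lemma maxmin_angleC p q U V : U != 0%VS -> \dim U = \dim V ->
  maxmin_angle (vflat p U) (vflat q V) = maxmin_angle (vflat q V) (vflat p U).
Proof.
move=> U0 dimE; have V0 : V != 0%VS by rewrite -dimv_eq0 -dimE dimv_eq0.
by apply/eqP; rewrite eq_le !maxmin_angle_swap_le.
Qed.

(** Complements reverse the order of dimensions, so [flat_angle] exchanges its arguments exactly as
    the duality does. In the case of equal dimensions it does not, and [maxmin_angleC] makes up for
    it. *)
Lemma flat_angle_orthov p q p' q' U V :
  U != 0%VS -> V != 0%VS -> orthov U != 0%VS -> orthov V != 0%VS ->
  (\dim U <= \dim V)%N ->
  flat_angle (vflat p' (orthov U)) (vflat q' (orthov V)) =
  flat_angle (vflat p U) (vflat q V).
Proof.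
move=> U0 V0 U0' V0' dimUV; rewrite /flat_angle !flat_dim_vflat dimUV.
rewrite -(maxmin_angle_orthov p q q' p' U0 V0 U0' V0').
case: ifP => [dimO|//].
apply: maxmin_angleC => //; apply/eqP; rewrite eqn_leq dimO.
by rewrite !dim_orthov leq_sub2l.
Qed.

End FlatAngle.

(** * Nearest points and empty balls *)

Section EuclideanTopology.
Context {R : realType} {d : nat}.
Implicit Types (x y z c : 'rV[R]_d) (e : R).

Lemma near_enorm x e : 0 < e -> \forall y \near x, enorm (y - x) < e.
Proof.
(* [d.+1] rather than [d] keeps the divisor positive when [d = 0]. *)
move=> e0; have d0 : 0 < d.+1%:R :> R by rewrite ltr0Sn.
have e1 : 0 < e / d.+1%:R by rewrite divr_gt0.
near=> y.
rewrite (le_lt_trans (enorm_le_mxnorm _)) //.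
rewrite (@le_lt_trans _ _ (d.+1%:R * `|y - x|)) //.
  by rewrite ler_wpM2r // ler_nat.
rewrite mulrC -ltr_pdivlMr // distrC.
Unshelve. all: by end_near. Qed.

Lemma nbhs_enormP x (P : set 'rV[R]_d) :
  nbhs x P <-> exists2 e, 0 < e & forall y, enorm (y - x) < e -> P y.
Proof.
split=> [/nbhs_ballP[e /= e0 h]|[e e0 h]].
  exists e => // y ye; apply: h; rewrite -ball_normE /= distrC.
  exact: le_lt_trans (mxnorm_le_enorm _) ye.
exact: (@filterS _ _ (nbhs_filter x) _ _ h (near_enorm x e0)).
Qed.

(** Exchanging [x] and [y] makes the one-sided bound two-sided; [L] has no prescribed sign, whence
    the divisor [|L| + 1]. *)
Lemma lipschitz_enorm_continuous (f : 'rV[R]_d -> R) (L : R) :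
  (forall x y, f x - f y <= L * enorm (x - y)) -> continuous f.
Proof.
move=> h x; apply/(@cvgrPdist_lt _ _ _ _ (nbhs_filter x)) => e e0.
have L0 : 0 < `|L| + 1 by rewrite ltr_wpDl.
have e1 : 0 < e / (`|L| + 1) by rewrite divr_gt0.
apply: (@filterS _ _ (nbhs_filter x) _ _ _ (near_enorm x e1)) => y ye.
have := h x y; have := h y x; rewrite (enormB x y) => h1 h2.
rewrite ltr_pdivlMr // in ye.
have : L * enorm (y - x) <= `|L| * enorm (y - x).
  by rewrite ler_wpM2r ?enorm_ge0 // ler_norm.
have := enorm_ge0 (y - x); rewrite ltr_norml => ? ?.
by apply/andP; split; nra.
Qed.

Lemma enorm_dist_continuous c : continuous (fun x => enorm (x - c)).
Proof.
apply: (@lipschitz_enorm_continuous _ 1) => x y.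
by have := enorm_triangle x y c; lra.
Qed.

Lemma compact_eball c e : compact [set x | enorm (x - c) <= e].
Proof.
apply: bounded_closed_compact; last first.
  apply: (@preimage_closed _ _ _ [set r | r <= e]); last exact: closed_le.
  by move=> x _; exact: enorm_dist_continuous.
exists (e + `|c|); split; first by rewrite num_real.
move=> M eM x /= xe; rewrite -(subrK c x) (le_trans (ler_normD _ _)) //.
have := le_trans (mxnorm_le_enorm (x - c)) xe; lra.
Qed.

End EuclideanTopology.

(** * Nearest points on a compact set and growth of the distance to it *)

Section NearestPoint.
Context {R : realType} {d : nat} (S : set 'rV[R]_d).
Hypotheses (compactS : compact S) (S0 : S !=set0).
Implicit Types (x y z c p q : 'rV[R]_d) (e h k : R).

Lemma compact_argmin (A : set 'rV[R]_d) x : compact A -> A !=set0 ->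
  exists q, nearest A x q.
Proof.
move=> cA A0.
have [|q qA qmin] := @EVT_min_rV R d (fun y => enorm (y - x)) A A0 cA.
  exact/continuous_subspaceT/enorm_dist_continuous.
exists q; split; first by rewrite inE in qA.
by move=> y yA; rewrite /eucdist !(enormB x) qmin ?inE.
Qed.

Definition edist x : R := eucdist x (xget 0 (nearest S x)).

Lemma edistE x q : nearest S x q -> edist x = eucdist x q.
Proof.
move=> xq; have [qS qmin] := xq.
have [pS pmin] := xgetPex 0 (ex_intro _ q xq).
by apply/eqP; rewrite eq_le pmin // qmin.
Qed.

Lemma edist_le x y : S y -> edist x <= eucdist x y.
Proof.
move=> yS; have [q xq] := compact_argmin x compactS S0.
by rewrite (edistE xq); case: xq => _; apply.
Qed.

Lemma edist_lip x y : edist x - edist y <= enorm (x - y).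
Proof.
have [q yq] := compact_argmin y compactS S0; rewrite (edistE yq).
have := edist_le x yq.1; have := enorm_triangle x y q; rewrite /eucdist; lra.
Qed.

Lemma edist_continuous : continuous edist.
Proof.
by apply: (@lipschitz_enorm_continuous _ _ _ 1) => x y; rewrite mul1r edist_lip.
Qed.

(** The points of [S] at distance at least [k] from [q] form a compact set, so they are farther from
    [x] than [q] by a positive gap. Moving [x] by less than half the gap cannot make one of them
    nearest. *)
Lemma nearest_continuous x q k :
  nearest S x q -> (forall z, nearest S x z -> z = q) -> 0 < k ->
  exists2 h, 0 < h & forall y z, enorm (y - x) < h -> nearest S y z ->
    enorm (z - q) < k.
Proof.
move=> xq uniq k0; pose A := S `&` [set z | k <= enorm (z - q)].
have cA : compact A.
  apply: compact_closedI => //.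
  apply: (@preimage_closed _ _ _ [set r | k <= r]); last exact: closed_ge.
  by move=> z _; exact: enorm_dist_continuous.
have [[z0 Az0]|A0] := pselect (A !=set0); last first.
  exists 1 => // y z _ [Sz _]; rewrite ltNge; apply/negP => kz.
  by apply: A0; exists z.
have [z [[Sz /= kz] zmin]] := compact_argmin x cA (ex_intro _ _ Az0).
have gap : 0 < eucdist x z - eucdist x q.
  rewrite subr_gt0 ltNge; apply/negP => zq.
  have zE : z = q.
    by apply: uniq; split => // y Sy; apply: le_trans zq _; apply: xq.2.
  by move: kz; rewrite zE subrr enorm0 leNgt k0.
exists ((eucdist x z - eucdist x q) / 2) => [|y w yx [Sw wmin]].
  by rewrite divr_gt0.
rewrite ltNge; apply/negP => kw.
have := zmin w (conj Sw kw); have := wmin q xq.1.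
have := enorm_triangle x y w; have := enorm_triangle y x q.
by rewrite /eucdist in yx gap *; rewrite (enormB x y); lra.
Qed.

(** A nearest point [z] of the moved point [y] is close to [q], so the motion is nearly along
    [x - z]. Projecting [y - z] on that direction gives [|y - z| >= |x - z| + t (1 - e)], and
    [|x - z| >= |x - q|]. *)
Lemma edist_grow x q e :
  nearest S x q -> (forall z, nearest S x z -> z = q) -> x != q ->
  0 < e -> e <= 1 ->
  exists2 h, 0 < h & forall t, 0 < t -> t < h ->
    edist x + t * (1 - e) <= edist (x + (t / enorm (x - q)) *: (x - q)).
Proof.
move=> xq uniq xNq e0 e1; set D := enorm (x - q).
have D0 : 0 < D by rewrite enorm_gt0 subr_eq0.
(* This tolerance [k] satisfies [(1 - e) (D + k) <= D - k]. *)
have k0 : 0 < e * D / 2 by rewrite divr_gt0 ?mulr_gt0.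
have [h h0 hP] := nearest_continuous xq uniq k0.
exists h => // t t0 th; set y := x + _.
have [z yz] := compact_argmin y compactS S0.
have yx : enorm (y - x) = t.
  rewrite /y addrAC subrr add0r enormZ -/D gtr0_norm ?divr_gt0 //.
  by rewrite divfK // gt_eqF.
have zq : enorm (z - q) < e * D / 2 by apply: hP yz; rewrite yx.
rewrite (edistE xq) (edistE yz) /eucdist -/D.
have DD := xq.2 z yz.1; rewrite /eucdist -/D in DD.
set D' := enorm (x - z) in DD.
have D'q : D' <= D + enorm (z - q) by rewrite (enormB z) enorm_triangle.
have D'0 : 0 < D' by exact: lt_le_trans DD.
have cs := dotv_le (y - z) (x - z); rewrite -/D' in cs.
have yzE : dotv (y - z) (x - z) = D' ^+ 2 + t / D * dotv (x - q) (x - z).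
  by rewrite sqr_enorm -dotvZl -dotvDl /y addrAC.
have xz : D * (D - enorm (z - q)) <= dotv (x - q) (x - z).
  have -> : x - z = (x - q) - (z - q) by rewrite opprB addrA subrK.
  rewrite dotvBr -sqr_enorm -/D expr2 mulrBr lerB //.
  exact: dotv_le.
have grow : t * (1 - e) * D' <= t / D * dotv (x - q) (x - z).
  apply: (@le_trans _ _ (t / D * (D * (D - enorm (z - q))))); last first.
    by rewrite ler_wpM2l // divr_ge0 // ltW.
  rewrite mulrA divfK ?gt_eqF // -mulrA ler_wpM2l //; first exact: ltW.
  apply: (@le_trans _ _ ((1 - e) * (D + e * D / 2))).
    by rewrite ler_wpM2l ?subr_ge0 // (le_trans D'q) // lerD2l ltW.
  by nra.
rewrite -(ler_pM2r D'0); nra.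
Qed.

(** The distance to [S] reaches [|c - p| + e] on the closed ball of radius [e] around [c]. No point
    of this ball is farther than that from [p], so the maximizer sits opposite to [p] and has [p] as
    a nearest point. *)
Lemma nearest_extend c p e :
  nearest S c p -> c != p -> 0 < e ->
  (forall x y z, enorm (x - c) <= e -> nearest S x y -> nearest S x z -> y = z) ->
  nearest S (p + (1 + e / enorm (c - p)) *: (c - p)) p.
Proof.
move=> cp cNp e0 uniq; set D := enorm (c - p).
have D0 : 0 < D by rewrite enorm_gt0 subr_eq0.
pose B := [set x | enorm (x - c) <= e].
have B0 : B !=set0 by exists c; rewrite /B /= subrr enorm0 ltW.
have cB : compact B := @compact_eball _ _ c e.
have [x xB xmax] : exists2 x, B x & D + e <= edist x.
  have [x xB xmax] := EVT_max_rV B0 cB (continuous_subspaceT edist_continuous).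
  rewrite inE in xB; exists x => //.
  apply/ler_addgt0Pl => k k0.
  (* Losing [n] in the growth rate costs at most [n e <= k] across the ball. *)
  pose n := Num.min 1 (k / e).
  have n0 : 0 < n by rewrite lt_min ltr01 divr_gt0.
  have n1 : n <= 1 by rewrite ge_min lexx.
  have ne : n * e <= k by rewrite -ler_pdivlMr // ge_min lexx orbT.
  (* Growth at nearly unit speed forces a maximizer of [f] onto the sphere. *)
  pose f y := edist y - (1 - n) * enorm (y - c).
  have cf : continuous f.
    apply: (@lipschitz_enorm_continuous _ _ _ 2) => y z.
    have := edist_lip y z; have := enorm_triangle z y c; rewrite (enormB z y).
    have := enorm_ge0 (y - z); rewrite /f; nra.
  have [y yB ymax] := EVT_max_rV B0 cB (continuous_subspaceT cf).
  rewrite inE in yB.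
  have yc : D <= edist y - (1 - n) * enorm (y - c).
    have := ymax c; rewrite inE /B /= subrr enorm0 ltW // => /(_ isT).
    by rewrite /f subrr enorm0 mulr0 subr0 (edistE cp).
  have [q yq] := compact_argmin y compactS S0.
  have yuniq z : nearest S y z -> z = q by move=> yz; exact: uniq yB yz yq.
  have yNq : y != q.
    apply: contraTneq D0 => yE; rewrite -leNgt (le_trans yc) // (edistE yq).
    by rewrite yE /eucdist subrr enorm0 sub0r oppr_le0 mulr_ge0 ?enorm_ge0 ?subr_ge0.
  have ye : enorm (y - c) = e.
    apply/eqP; rewrite eq_le yB /= leNgt; apply/negP => ye.
    (* Growth at rate [1 - n / 2] beats the penalty rate [1 - n] of [f], so an interior [y] would
       not be a maximizer. *)
    have n2 : 0 < n / 2 by rewrite divr_gt0.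
    have n21 : n / 2 <= 1 by lra.
    have [h h0 hP] := edist_grow yq yuniq yNq n2 n21.
    pose t := Num.min (h / 2) (e - enorm (y - c)).
    have t0 : 0 < t by rewrite lt_min divr_gt0 //= subr_gt0.
    have th : t < h by rewrite gt_min; apply/orP; left; lra.
    have te : t <= e - enorm (y - c) by rewrite ge_min lexx orbT.
    have := hP t t0 th; set w := y + _ => grow.
    have wy : enorm (w - y) = t.
      rewrite /w addrAC subrr add0r enormZ.
      have yq0 : 0 < enorm (y - q) by rewrite enorm_gt0 subr_eq0.
      by rewrite gtr0_norm ?divr_gt0 // divfK // gt_eqF.
    have wc : enorm (w - c) <= enorm (y - c) + t.
      by have := enorm_triangle w y c; rewrite wy; lra.
    have wB : w \in B by rewrite inE /B /=; lra.
    by have := ymax w wB; rewrite /f; nra.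
  have := xmax y; rewrite inE => /(_ yB) => yx.
  by rewrite ye in yc; nra.
(* Equality in [|x - p| <= |x - c| + |c - p|] puts [x] on the ray from [p]
   through [c]. *)
have xE : x = p + (1 + e / D) *: (c - p).
  have xc : x - c = (e / D) *: (c - p).
    apply/eqP; rewrite -subr_eq0 -dotv_eq0.
    have xp : (D + e) ^+ 2 <= dotv (x - p) (x - p).
      rewrite -sqr_enorm ler_pXn2r ?nnegrE ?enorm_ge0 //.
        exact: le_trans xmax (edist_le x cp.1).
      by rewrite addr_ge0 // ltW.
    have xpE : x - p = (x - c) + (c - p) by rewrite addrA subrK.
    have xc2 : dotv (x - c) (x - c) <= e ^+ 2.
      by rewrite -sqr_enorm ler_pXn2r ?nnegrE ?enorm_ge0 //; exact: ltW.
    have D2 : dotv (c - p) (c - p) = D ^+ 2 by rewrite sqr_enorm.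
    rewrite eq_le dotv_ge0 andbT.
    have dotE : e * D <= dotv (x - c) (c - p).
      move: xp; rewrite xpE !dotvE; move: xc2 D2; rewrite !dotvE.
      rewrite !(dotvC c x) !(dotvC p x) !(dotvC p c); nra.
    move: (x - c) (c - p) xc2 dotE D2 => a b xc2 dotE D2.
    (* With [|a| <= e], [|b| = D] and [<a, b> >= e D], this square is at most
       [e^2 - 2 e^2 + e^2 = 0]. *)
    have -> : dotv (a - (e / D) *: b) (a - (e / D) *: b) =
        dotv a a - e / D * dotv a b *+ 2 + e ^+ 2.
      by rewrite !dotvE (dotvC b a) D2; field; rewrite gt_eqF.
    have : e * e <= e / D * dotv a b.
      rewrite -mulrA ler_wpM2l //; first exact: ltW.
      by rewrite mulrC ler_pdivlMr.
    by rewrite expr2 in xc2 *; lra.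
  by rewrite -(subrK c x) xc scalerDl scale1r addrA addrCA subrr addr0 addrC.
rewrite -xE; split; first exact: cp.1.
move=> y Sy; apply: le_trans (edist_le x Sy); apply: le_trans xmax.
rewrite xE /eucdist addrAC subrr add0r enormZ -/D gtr0_norm ?addr_gt0 ?divr_gt0 //.
by rewrite mulrDl mul1r divfK ?gt_eqF.
Qed.

End NearestPoint.

(** * Empty balls tangent to the set at a point *)

Section EmptyBalls.
Context {R : realType} {d : nat} (S : set 'rV[R]_d).
Hypothesis compactS : compact S.
Implicit Types (x y z v n : 'rV[R]_d) (e h k r s t : R).

(** First-order contact: the component of [q - v] along [n] is [o(|q - v|)] on [S]. *)
Definition flat_along v n := forall k, 0 < k ->
  exists2 h, 0 < h & forall q, S q -> enorm (q - v) < h ->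
    `|dotv (q - v) n| <= k * enorm (q - v).

Lemma not_medial_axis x : ~ medial_axis S x ->
  exists2 r, 0 < r & forall y p q, enorm (y - x) < r ->
    nearest S y p -> nearest S y q -> p = q.
Proof.
move=> xM.
have : nbhs x (~` [set x | exists p q, [/\ p != q, nearest S x p & nearest S x q]]).
  rewrite -[nbhs x _]/((~` _)° x) interiorC; exact: xM.
move=> /nbhs_enormP[r r0 rP]; exists r => // y p q /rP yP yp yq.
by apply/eqP/negPn/negP => pq; apply: yP; exists p, q.
Qed.

(** Squaring the distances cancels [t^2] and leaves a condition linear in [t], which passes to
    suprema of [t]. *)
Lemma nearest_rayP v n t : S v -> dotv n n = 1 -> 0 <= t ->
  nearest S (v + t *: n) v <->
  forall y, S y -> 2 * t * dotv (y - v) n <= dotv (y - v) (y - v).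
Proof.
move=> Sv n1 t0.
have ballE y : (eucdist (v + t *: n) v <= eucdist (v + t *: n) y) =
    (2 * t * dotv (y - v) n <= dotv (y - v) (y - v)).
  rewrite /eucdist addrAC subrr add0r -ler_sqr ?nnegrE ?enorm_ge0 //.
  rewrite !sqr_enorm.
  have -> : v + t *: n - y = t *: n - (y - v).
    by rewrite opprB addrCA addrA.
  move: (y - v) => z; rewrite !dotvE n1 (dotvC n z) -subr_ge0.
  by rewrite -[RHS]subr_ge0; congr (0 <= _); ring.
by split=> [[_ h] y /h|h]; [rewrite ballE|split => // y /h; rewrite ballE].
Qed.

(* Points [v + r n] have nearest points [q] close to [v], and by
   [nearest_extend] each ray from [q] extends by a fixed length [rho].  As
   [r -> 0] its direction tends to [n], because [q - v] is nearly orthogonal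
   to [n].  Only first-order contact is needed, no bound on the curvature. *)
Lemma nearest_ray_start v n : S v -> dotv n n = 1 -> flat_along v n ->
  ~ medial_axis S v -> exists2 r, 0 < r & nearest S (v + r *: n) v.
Proof.
move=> Sv n1 flat /not_medial_axis[r0 r0_gt0 uniq].
have en1 : enorm n = 1 by rewrite /enorm n1 sqrtr1.
pose rho := r0 / 4; have rho0 : 0 < rho by rewrite divr_gt0.
exists rho => //; split => // y Sy.
rewrite {1}/eucdist addrAC subrr add0r enormZ en1 mulr1 gtr0_norm //.
rewrite leNgt; apply/negP => gap; set D0 := eucdist _ _ in gap.
(* A point [y] in the ball leaves a gap [g]. The final estimate loses at most [r <= g / 8] from the
   displaced center and [rho m <= g / 4] from the tilted direction, too little to close it. *)
pose g := rho - D0; have g0 : 0 < g by rewrite subr_gt0.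
pose m := Num.min 1 (g / (4 * rho)).
have m0 : 0 < m by rewrite lt_min ltr01 divr_gt0 ?mulr_gt0.
have m1 : m <= 1 by rewrite ge_min lexx.
have mg : m * (4 * rho) <= g by rewrite -ler_pdivlMr ?mulr_gt0 // ge_min lexx orbT.
(* Chosen so that [<w, n> >= 1 - 2 k] gives [|w - n|^2 <= 4 k = m^2] for the unit vectors [w] and
   [n]. *)
pose k := m ^+ 2 / 4; have k0 : 0 < k by rewrite divr_gt0 ?exprn_gt0.
have k4 : k <= 1 / 4 by rewrite /k ler_pM2r ?invr_gt0 // expr_le1 // ltW.
have [h h0 hP] := flat k k0.
pose r := Num.min (h / 4) (Num.min (g / 8) (r0 / 4)).
have r_gt0 : 0 < r by rewrite !lt_min !divr_gt0.
have rh : r <= h / 4 by rewrite ge_min lexx.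
have rg : r <= g / 8 by rewrite !ge_min lexx orbT.
have rr0 : r <= r0 / 4 by rewrite !ge_min lexx !orbT.
pose x := v + r *: n.
have xv : enorm (x - v) = r.
  by rewrite /x addrAC subrr add0r enormZ en1 mulr1 gtr0_norm.
have [q xq] := compact_argmin x compactS (ex_intro _ v Sv).
have xqr : enorm (x - q) <= r by have := xq.2 v Sv; rewrite /eucdist xv.
have qv : enorm (q - v) <= 2 * r.
  by have := enorm_triangle q x v; rewrite xv (enormB q x); lra.
have qvn : `|dotv (q - v) n| <= k * (2 * r).
  by rewrite (le_trans (hP q xq.1 _)) ?ler_pM2l //; lra.
have xqn : r * (1 - 2 * k) <= dotv (x - q) n.
  have -> : x - q = r *: n - (q - v) by rewrite /x opprB addrCA addrA.
  by rewrite dotvBl dotvZl n1; move: qvn; rewrite ler_norml => /andP[]; lra.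
set D := enorm (x - q) in xqr.
have D_gt0 : 0 < D.
  have := dotv_le (x - q) n; rewrite en1 mulr1 -/D; nra.
have xNq : x != q by rewrite -subr_eq0 -enorm_gt0.
have [_ ext] : nearest S (q + (1 + rho / D) *: (x - q)) q.
  apply: nearest_extend => //; first by exists v.
  move=> z z1 z2 zx; apply: uniq.
  by have := enorm_triangle z x v; rewrite xv /rho in zx *; lra.
have := ext y Sy; rewrite /eucdist addrAC subrr add0r enormZ -/D.
rewrite gtr0_norm ?addr_gt0 ?divr_gt0 // mulrDl mul1r divfK ?gt_eqF // => far.
pose w := D^-1 *: (x - q).
have wn : dotv (w - n) (w - n) <= m ^+ 2.
  have ww : dotv w w = 1.
    by rewrite /w dotvZl dotvZr -sqr_enorm -/D; field; rewrite gt_eqF.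
  have : 1 - 2 * k <= dotv w n.
    rewrite /w dotvZl [leRHS]mulrC ler_pdivlMr //; apply: le_trans xqn.
    by rewrite mulrC ler_wpM2r //; lra.
  move: ww; move: w => u uu un.
  by rewrite !dotvE uu n1 (dotvC n u); rewrite /k in un; lra.
have wnm : enorm (w - n) <= m.
  by rewrite -ler_sqr ?nnegrE ?enorm_ge0 ?sqr_enorm //; exact: ltW.
have split_far : q + (1 + rho / D) *: (x - q) - y =
    (v + rho *: n - y) + ((x - v) + rho *: (w - n)).
  have -> : (1 + rho / D) *: (x - q) = (x - q) + rho *: w.
    by rewrite scalerDl scale1r scalerA.
  by apply/rowP => i; rewrite !mxE; ring.
move: far; rewrite split_far => far.
have := enormD (v + rho *: n - y) (x - v + rho *: (w - n)).
have := enormD (x - v) (rho *: (w - n)); rewrite xv enormZ gtr0_norm //.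
have : rho * enorm (w - n) <= rho * m by rewrite ler_pM2l.
rewrite -/(eucdist _ _) -/D0 in far *; rewrite /g in rg mg; lra.
Qed.

(** If the claim fails, the supremum [s] of the good parameters is itself good and less than [e].
    Since [v + s n] is off the medial axis, a larger parameter is good as well, a contradiction. *)
Lemma nearest_ray v n e : S v -> dotv n n = 1 -> flat_along v n -> 0 <= e ->
  (forall s, 0 <= s -> s < e -> ~ medial_axis S (v + s *: n)) ->
  nearest S (v + e *: n) v.
Proof.
move=> Sv n1 flat e0 noM; apply/nearest_rayP => // y0 Sy0.
rewrite leNgt; apply/negP => y0_in.
pose E := [set s | 0 <= s /\
  forall y, S y -> 2 * s * dotv (y - v) n <= dotv (y - v) (y - v)].
have E0 : E 0.
  by split => // y _; rewrite mulr0 mul0r dotv_ge0.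
(* The condition already fails at [e] for [y0], and a failure persists for larger parameters. *)
have Ee : ubound E e.
  move=> s [s0 /(_ y0 Sy0)]; rewrite leNgt => sy; rewrite leNgt.
  apply: contra sy => es; apply: (lt_le_trans y0_in).
  have : 0 < 2 * e * dotv (y0 - v) n by exact: le_lt_trans (dotv_ge0 _) y0_in.
  by nra.
have supE : has_sup E by split; [exists 0|exists e].
pose s := sup E.
have s0 : 0 <= s by apply: ub_le_sup => //; exists e.
have Es : forall y, S y -> 2 * s * dotv (y - v) n <= dotv (y - v) (y - v).
  move=> y Sy; have [yn|yn] := leP (dotv (y - v) n) 0.
    by rewrite (le_trans _ (dotv_ge0 _)) // mulr_ge0_le0 // mulr_ge0.
  rewrite -ler_pdivlMr // mulrC -ler_pdivlMr //.
  apply: ge_sup; first by exists 0.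
  by move=> t [t0 /(_ y Sy) ty]; rewrite ler_pdivlMr // mulrC ler_pdivlMr.
have se : s < e.
  rewrite lt_neqAle ge_sup //; last by exists 0.
  rewrite andbT; apply: contraTneq y0_in => <-.
  by rewrite -leNgt Es.
suff [t st Et] : exists2 t, s < t & E t.
  by have := ub_le_sup (ex_intro _ e Ee) Et; rewrite leNgt st.
(* At [s = 0] the center is [v] itself and defines no ray, so [nearest_extend] gives way to
   [nearest_ray_start]. *)
have [s_eq0|s_neq0] := eqVneq s 0.
  have vM : ~ medial_axis S v.
    by have := noM 0 (lexx 0); rewrite scale0r addr0; apply; rewrite -s_eq0.
  have [r r0 vr] := nearest_ray_start Sv n1 flat vM.
  exists r; first by rewrite s_eq0.
  by split; [exact: ltW|apply/nearest_rayP => //; exact: ltW].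
have s_gt0 : 0 < s by rewrite lt_def s_neq0.
have [r r0 uniq] := not_medial_axis (noM s s0 se).
have r2 : 0 < r / 2 by rewrite divr_gt0.
have cv : nearest S (v + s *: n) v by apply/nearest_rayP.
have en1 : enorm n = 1 by rewrite /enorm n1 sqrtr1.
have csE : v + s *: n - v = s *: n by rewrite addrAC subrr add0r.
have cNv : v + s *: n != v.
  by rewrite -subr_eq0 csE -enorm_gt0 enormZ en1 mulr1 normr_gt0.
have uniq2 x y z : enorm (x - (v + s *: n)) <= r / 2 ->
    nearest S x y -> nearest S x z -> y = z.
  by move=> xr; apply: uniq; lra.
have := nearest_extend compactS (ex_intro _ v Sv) cv cNv r2 uniq2.
rewrite csE enormZ en1 mulr1 gtr0_norm // scalerA mulrDl mul1r divfK // => vt.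
exists (s + r / 2); first by rewrite ltrDl.
have t0 : 0 <= s + r / 2 by rewrite addr_ge0 // ltW.
by split=> //; apply/nearest_rayP.
Qed.

(** For [0 <= s < e] the point [v + s n] of the normal flat is at distance [s] from [v], below
    [ebs S v], hence off the medial axis. *)
Lemma ebs_dotv_le v n e y : S v -> dotv n n = 1 -> flat_along v n ->
  normal_flat S v (v + n) -> 0 <= e -> (e%:E <= ebs S v)%E -> S y ->
  2 * e * dotv (y - v) n <= dotv (y - v) (y - v).
Proof.
move=> Sv n1 flat nN e0 e_ebs; move: y; apply/nearest_rayP => //.
apply: nearest_ray => // s s0 se sM.
have : (ebs S v <= s%:E)%E.
  apply: ereal_inf_lbound; exists (v + s *: n); last first.
    rewrite /eucdist opprD addrA subrr add0r enormN enormZ /enorm n1 sqrtr1.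
    by rewrite mulr1 ger0_norm.
  split => // u uT; have := nN u uT.
  have vE z : v + z - v = z by rewrite addrAC subrr add0r.
  by rewrite !vE dotvZl => ->; rewrite mulr0.
by move=> /(le_trans e_ebs); rewrite lee_fin leNgt se.
Qed.

End EmptyBalls.

(** * Tangent spaces *)

Section TangentSpace.
Context {R : realType} {d : nat}.
Local Notation E := 'rV[R]_d.
Implicit Types (p q u v w x y z : E) (f g : E -> E) (S : set E).

Lemma diff_enorm_le f x (e : R) : differentiable f x -> 0 < e ->
  exists2 h, 0 < h & forall z, enorm (z - x) < h ->
    enorm (f z - f x - 'd f x (z - x)) <= e * enorm (z - x).
Proof.
move=> /diff_locally/eqaddoP fx e0.
have e1 : 0 < e / d.+1%:R by rewrite divr_gt0.
have /nbhs_enormP[h h0 hP] := fx _ e1.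
exists h => // z zx; have := hP (z - x); rewrite subr0 => /(_ zx).
rewrite -[X in `|X|]/(f (z - x + x) - (f x + 'd f x (z - x))) subrK opprD addrA.
move=> zP; apply: (le_trans (enorm_le_mxnorm _)).
apply: (@le_trans _ _ (d.+1%:R * (e / d.+1%:R * `|z - x|))).
  by apply: ler_pM => //; rewrite ler_nat.
by rewrite mulrA mulrCA divff ?pnatr_eq0 // mulr1 ler_wpM2l ?mxnorm_le_enorm // ltW.
Qed.

Lemma diff_enorm_lip f x : differentiable f x ->
  exists K h, [/\ 0 < K, 0 < h & forall z, enorm (z - x) < h ->
    enorm (f z - f x) <= K * enorm (z - x)].
Proof.
move=> fx; have [h h0 hP] := diff_enorm_le fx ltr01.
have [K K0 KP] := linear_lipschitz (diff_continuous fx).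
exists (d%:R * K + 1), h; split => //; first by rewrite ltr_wpDl // mulr_ge0 // ltW.
move=> z /hP zx; rewrite -[f z - f x](subrK ('d f x (z - x))).
apply: (le_trans (enormD _ _)); rewrite mulrDl addrC lerD //.
apply: (le_trans (enorm_le_mxnorm _)); rewrite -mulrA ler_wpM2l //.
by apply: (le_trans (KP _)); rewrite ler_wpM2l ?mxnorm_le_enorm // ltW.
Qed.

(** Applied to both compositions of a chart with its inverse, to make their differentials mutually
    inverse. *)
Lemma diff_near_id f x : differentiable f x -> (\forall z \near x, f z = z) ->
  forall v, 'd f x v = v.
Proof.
move=> fx near_id v; have [->|v0] := eqVneq v 0; first by rewrite linear0.
rewrite -deriveE // -[RHS](derive_id x v).
by apply: near_eq_derive.
Qed.

Lemma is_derive_line g y w : differentiable g y ->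
  is_derive (0 : R) 1 (fun t : R => g (t *: w + y)) ('d g y w).
Proof.
move=> gy; have line_diff : differentiable (fun t : R => t *: w + y) (0 : R) by [].
have g0 : differentiable g (0 *: w + y) by rewrite scale0r add0r.
have gl := differentiable_comp line_diff g0.
apply: DeriveDef; first exact/derivable1_diffP.
rewrite deriveE // (diff_comp line_diff g0) /= scale0r add0r.
by rewrite diff_val /= [X in 'd g y X](_ : _ = w) //= -[RHS]scale1r -[RHS]addr0.
Qed.

Definition coord_embed k : 'Hom('rV[R]_k, E) := linfun (mulmxr (pid_mx k)).

Definition coord_space k : {vspace E} := limg (coord_embed k).

Lemma dim_coord_space k : (k <= d)%N -> \dim (coord_space k) = k.
Proof.
move=> kd; have kerP : lker (coord_embed k) == 0%VS.
  apply/lker0P/(@can_inj _ _ _ (mulmxr (pid_mx k : 'M[R]_(d, k)))) => v.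
  rewrite lfunE /= -mulmxA mul_pid_mx minnn (minn_idPr kd).
  by rewrite pid_mx_1 mulmx1.
rewrite limg_dim_eq; last by rewrite (eqP kerP) capv0.
by rewrite dimvf /dim /= mul1n.
Qed.

Lemma mem_coord_space k x :
  reflect (forall i : 'I_d, (k <= i)%N -> x 0 i = 0) (x \in coord_space k).
Proof.
apply: (iffP memv_imgP) => [[w _ ->] i ki|x0].
  rewrite lfunE /= mxE big1 // => j _; rewrite mxE.
  by rewrite (ltn_eqF (leq_trans (ltn_ord j) ki)) mulr0.
exists (x *m pid_mx k); first by rewrite memvf.
rewrite lfunE /= -mulmxA; apply/rowP => i; rewrite mxE (bigD1 i) //= big1.
  rewrite addr0 mul_pid_mx mxE eqxx /=.
  have [ki|ki] := leqP k i; first by rewrite x0 // mul0r.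
  by rewrite !minnn ki mulr1.
move=> j ji; rewrite mul_pid_mx mxE.
by rewrite (_ : (j == i :> nat) = false) ?mulr0 //; exact/negbTE.
Qed.

(** [T] is the image of [coord_space k] under the differential of the inverse chart [g]. The last
    clause is the first-order contact from which [flat_along] is derived. *)
Lemma tangent_space k S p : (k <= d)%N -> smooth_submanifold k S -> S p ->
  exists T : {vspace E}, [/\ \dim T = k, tangent_vec S p = [set u | u \in T] &
    forall e : R, 0 < e -> exists2 h, 0 < h & forall q, S q ->
      enorm (q - p) < h ->
      exists2 u, u \in T & enorm (q - p - u) <= e * enorm (q - p)].
Proof.
move=> kd Sk Sp; have [U [V [f [g [oU oV Up [sf sg fP gP] chart]]]]] := Sk p Sp.
have fd : differentiable f p by have [+ _] := sf 1%N; apply.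
have [Vy gfp] := fP p Up; set y0 := f p in Vy gfp.
have gd : differentiable g y0 by have [+ _] := sg 1%N; apply.
have gd' : differentiable f (g y0) by rewrite gfp.
have nU : nbhs p U by exact: open_nbhs_nbhs.
have nV : nbhs y0 V by exact: open_nbhs_nbhs.
have fgK v : 'd f p ('d g y0 v) = v.
  have -> : 'd f p ('d g y0 v) = 'd f (g y0) ('d g y0 v) by rewrite gfp.
  rewrite -[LHS]/(('d f (g y0) \o 'd g y0) v) -(diff_comp gd gd').
  apply: diff_near_id; first exact: differentiable_comp.
  by apply: filterS nV => y /gP[].
have gfK v : 'd g y0 ('d f p v) = v.
  rewrite -[LHS]/(('d g (f p) \o 'd f p) v) -(diff_comp fd gd).
  apply: diff_near_id; first exact: differentiable_comp.
  by apply: filterS nU => x /fP[].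
have y0L : y0 \in coord_space k by apply/mem_coord_space/chart.
pose T := (linfun ('d g y0) @: coord_space k)%VS.
have memT w : w \in coord_space k -> 'd g y0 w \in T.
  by move=> wL; rewrite -[X in X \in _](lfunE ('d g y0) w) memv_img.
exists T; split.
- rewrite limg_dim_eq ?dim_coord_space //.
  apply/eqP; rewrite -subv0; apply/subvP => w.
  rewrite memv_cap memv_ker lfunE memv0 => /andP[_ /eqP w0].
  by have := congr1 ('d f p) w0; rewrite fgK linear0 => ->.
(* The chart sends a curve in [S] into the slice, so the derivative of its image has zero
   coordinates from index [k] on. Conversely, [g] sends lines of the slice to curves in [S]. *)
- apply/seteqP; split => [u [c [c0 cS cu]]|_ /memv_imgP[w wL ->]] /=.
    have fcE : is_derive (0 : R) 1 (f \o c) ('d f p u).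
      have cd : differentiable c (0 : R) by apply/derivable1_diffP; case: cu.
      have fcd : differentiable f (c 0) by rewrite c0.
      have fc := differentiable_comp cd fcd.
      apply: DeriveDef; first exact/derivable1_diffP.
      have cdu : 'd c (0 : R) 1 = u by rewrite -(deriveE (1 : R) cd); case: cu.
      have dE := congr1 (fun q => 'd f q u) c0.
      rewrite (deriveE (1 : R) fc) (diff_comp cd fcd) -[RHS]dE.
      by rewrite -[in RHS]cdu.
    rewrite -(gfK u); apply/memT/mem_coord_space => i ki.
    have cc : c @ (0 : R) --> p.
      rewrite -c0; apply: differentiable_continuous.
      by apply/derivable1_diffP; case: cu.
    have fc0 : \forall t \near (0 : R), (f \o c) t 0 i = 0.
      have := cc _ nU; rewrite /nbhs /= => cU; near=> t.
      have Uct : U (c t) by near: t.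
      have Sct : S (c t) by near: t.
      by move/(chart _ Uct)/(_ i ki): Sct.
    case: fcE => fcd <-; rewrite derive_mx // mxE.
    rewrite -[RHS](derive_cst (0 : R) (0 : R) (1 : R)).
    exact: near_eq_derive.
  rewrite lfunE; exists (fun t => g (t *: w + y0)); split.
  + by rewrite scale0r add0r.
  + have ty0 : (fun t : R => t *: w + y0) @ (0 : R) --> y0.
      rewrite -[X in _ --> X](add0r y0) -[X in X + _](scale0r w).
      apply: cvgD; last exact: cvg_cst.
      by apply: cvgZr_tmp.
    have := ty0 _ nV; rewrite /nbhs /= => Vt; near=> t.
    have Vt' : V (t *: w + y0) by near: t.
    have [Ut ft] := gP _ Vt'; apply/(chart _ Ut) => i ki; rewrite ft.
    by apply/mem_coord_space: ki; rewrite rpredD // rpredZ.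
  + exact: is_derive_line.
move=> e e0.
have [K [h1 [K0 h1_gt0 fL]]] := diff_enorm_lip fd.
(* [q - p] is [g (f q) - g (f p)], and the linearization error of [g] is measured by
   [|f q - f p| <= K |q - p|]. *)
have eK : 0 < e / K by rewrite divr_gt0.
have [h2 h2_gt0 gE] := diff_enorm_le gd eK.
have [h3 h3_gt0 hU] : exists2 h, 0 < h & forall y, enorm (y - p) < h -> U y.
  exact/nbhs_enormP.
pose h := Num.min h1 (Num.min (h2 / K) h3).
exists h; first by rewrite !lt_min h1_gt0 divr_gt0.
move=> q Sq; rewrite !lt_min => /and3P[q1 q2 q3].
have Uq := hU q q3; have [Vfq gfq] := fP q Uq.
exists ('d g y0 (f q - y0)).
  by apply: memT; rewrite rpredB //; apply/mem_coord_space/chart.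
have fq := fL q q1.
rewrite -{1}gfq -{1}gfp; apply: le_trans (gE (f q) _) _.
  by apply: le_lt_trans fq _; rewrite mulrC -ltr_pdivlMr.
apply: (@le_trans _ _ (e / K * (K * enorm (q - p)))).
  by rewrite ler_pM2l.
by rewrite mulrA divfK // gt_eqF.
Unshelve. all: by end_near. Qed.

End TangentSpace.

(** * Triangles *)

Section CircleBound.
Context {R : realType}.
Implicit Types (a b c s t k : R).

(* Cauchy-Schwarz for the form [s^2 + t^2 + 2 s t c] and its dual. *)
Lemma dual_form_le a b c s t :
  (1 - c ^+ 2) * (s * a + t * b) ^+ 2 <=
  (a ^+ 2 + b ^+ 2 - 2 * a * b * c) * (s ^+ 2 + t ^+ 2 + 2 * s * t * c).
Proof.
rewrite -subr_ge0.
by rewrite (_ : _ - _ = (s * (b - a * c) - t * (a - b * c)) ^+ 2) ?sqr_ge0 //; ring.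
Qed.

(** For [s], [t] of equal sign this is [dual_form_le] with [k >= 1]. For opposite signs [b] becomes
    [- b], and [k] absorbs the ratio of [a^2 + b^2 + 2 a b c] to [a^2 + b^2 - 2 a b c]; for [c > 0]
    this ratio is largest at [a = b], where it is [(1 + c) / (1 - c)]. *)
Lemma circle_form_le a b c s t k : 0 < a -> 0 < b -> -1 < c -> c < 1 ->
  1 <= k -> 1 + c <= k * (1 - c) ->
  (1 - c ^+ 2) * (`|s| * a + `|t| * b) ^+ 2 <=
  (a ^+ 2 + b ^+ 2 - 2 * a * b * c) * k * (s ^+ 2 + t ^+ 2 + 2 * s * t * c).
Proof.
move=> a0 b0 c1 c2 k1 kc.
have q_ge0 s' t' : 0 <= s' ^+ 2 + t' ^+ 2 + 2 * s' * t' * c.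
  have -> : s' ^+ 2 + t' ^+ 2 + 2 * s' * t' * c =
      (s' + t' * c) ^+ 2 + t' ^+ 2 * (1 - c ^+ 2) by ring.
  by rewrite addr_ge0 ?sqr_ge0 // mulr_ge0 ?sqr_ge0 //; nra.
have Q_ge0 : 0 <= a ^+ 2 + b ^+ 2 - 2 * a * b * c.
  by have := q_ge0 a (- b); congr (0 <= _); ring.
have Q_le : a ^+ 2 + b ^+ 2 + 2 * a * b * c <= (a ^+ 2 + b ^+ 2 - 2 * a * b * c) * k.
  have ab := mulr_gt0 a0 b0.
  have [c0|c0] := leP c 0.
    apply: (@le_trans _ _ (a ^+ 2 + b ^+ 2 - 2 * a * b * c)).
      by have := mulr_ge0_le0 (ltW ab) c0; lra.
    by rewrite ler_peMr.
  rewrite -(@ler_pM2r _ (1 - c)) ?subr_gt0 // -[leRHS]mulrA.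
  apply: (@le_trans _ _ ((a ^+ 2 + b ^+ 2 - 2 * a * b * c) * (1 + c))); last first.
    by rewrite ler_wpM2l.
  rewrite -subr_ge0 (_ : _ - _ = 2 * c * (a - b) ^+ 2); last by ring.
  by rewrite mulr_ge0 ?sqr_ge0 // mulr_ge0 // ltW.
have same : (1 - c ^+ 2) * (s * a + t * b) ^+ 2 <=
    (a ^+ 2 + b ^+ 2 - 2 * a * b * c) * k * (s ^+ 2 + t ^+ 2 + 2 * s * t * c).
  by apply: (le_trans (dual_form_le a b c s t)); rewrite ler_wpM2r // ler_peMr.
have opp : (1 - c ^+ 2) * (s * a - t * b) ^+ 2 <=
    (a ^+ 2 + b ^+ 2 - 2 * a * b * c) * k * (s ^+ 2 + t ^+ 2 + 2 * s * t * c).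
  have := dual_form_le a (- b) c s t; rewrite mulrN sqrrN => h.
  by apply: (le_trans h); rewrite ler_wpM2r //; move: Q_le; congr (_ <= _); ring.
case: (ger0P s) => s0; case: (ger0P t) => t0 //.
- by rewrite mulNr.
- by have -> : (- s * a + t * b) ^+ 2 = (s * a - t * b) ^+ 2 by ring.
- by rewrite !mulNr -opprD sqrrN.
Qed.

(** Half-angle formulas: [1 + c = 2 cos^2 h] and [1 - c = 2 sin^2 h], so [cot h] alone would give
    equality. *)
Lemma cot_half_acos c : -1 < c -> c < 1 ->
  1 + c <= Num.max (cot (acos c / 2)) 1 ^+ 2 * (1 - c).
Proof.
move=> c1 c2; set h := acos c / 2.
have h0 : 0 < h by rewrite divr_gt0 // acos_gt0 // c2 ltW.
have hpi : h < pi / 2 by rewrite ltr_pM2r ?invr_gt0 // acos_ltpi // c1 ltW.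
have sh : 0 < sin h by rewrite sin_gt0_pi // h0 /=; have := @pi_gt0 R; lra.
have ch : 0 < cos h by rewrite cos_gt0_pihalf // hpi andbT; have := @pi_gt0 R; lra.
have cE : c = cos (h + h) by rewrite /h -splitr acosK // in_itv /= !ltW.
have cs := cos2Dsin2 h.
rewrite cosD in cE.
have cot0 : 0 <= cot h by rewrite divr_ge0 // ltW.
apply: (@le_trans _ _ (cot h ^+ 2 * (1 - c))); last first.
  rewrite ler_wpM2r //; first by rewrite subr_ge0 ltW.
  rewrite ler_pXn2r ?nnegrE //.
    by rewrite le_max lexx.
  by rewrite le_max ler01 orbT.
have s2 : 1 - c = 2 * sin h ^+ 2 by rewrite cE !expr2; rewrite !expr2 in cs; lra.
have c2' : 1 + c = 2 * cos h ^+ 2 by rewrite cE !expr2; rewrite !expr2 in cs; lra.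
rewrite c2' s2 /cot.
suff -> : (cos h / sin h) ^+ 2 * (2 * sin h ^+ 2) = 2 * cos h ^+ 2 by [].
by field; rewrite gt_eqF.
Qed.

End CircleBound.

(** * Edge coordinates, circumcenter and circumradius *)

Section TriangleGeometry.
Context {R : realType} {d : nat}.
Implicit Types (i j : 'I_3) (tau : 'I_3 -> 'rV[R]_d) (u w x y v : 'rV[R]_d).

Lemma ord3_neq i : [/\ i + 1 != i, i - 1 != i & i - 1 != i + 1].
Proof. by case: i => [[|[|[|//]]] ?]; split; apply/eqP => /(congr1 val). Qed.

Lemma ord3_cases i j : [\/ j = i, j = i + 1 | j = i - 1].
Proof.
case: i j => [[|[|[|//]]] ?] [[|[|[|//]]] ?];
  by [apply: Or31; apply: val_inj|apply: Or32; apply: val_inj|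
      apply: Or33; apply: val_inj].
Qed.

Lemma sum_ord3 (V : zmodType) (F : 'I_3 -> V) i :
  \sum_j F j = F i + F (i + 1) + F (i - 1).
Proof.
have [i1 i2 i3] := ord3_neq i.
rewrite (bigD1 i) //= (bigD1 (i + 1)) //= (bigD1 (i - 1)) /=; last first.
  by rewrite i2 i3.
rewrite big1 ?addr0 ?addrA // => j; case: (ord3_cases i j) => ->.
- by rewrite eqxx.
- by rewrite eqxx andbF.
- by rewrite eqxx !andbF.
Qed.

Definition edge1 tau i := tau (i + 1) - tau i.
Definition edge2 tau i := tau (i - 1) - tau i.

Definition edge_span tau i : {vspace 'rV[R]_d} :=
  (<[edge1 tau i]> + <[edge2 tau i]>)%VS.

Lemma edge_spanP tau i x :
  reflect (exists s t, x = s *: edge1 tau i + t *: edge2 tau i)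
    (x \in edge_span tau i).
Proof.
apply: (iffP memv_addP) => [[_ /vlineP[s ->] [_ /vlineP[t ->] ->]]|[s [t ->]]].
  by exists s, t.
by exists (s *: edge1 tau i); rewrite ?memvZ ?memv_line //;
  exists (t *: edge2 tau i); rewrite ?memvZ ?memv_line.
Qed.

Lemma bary_ord3 tau i (a : 'I_3 -> R) : \sum_j a j = 1 ->
  \sum_j a j *: tau j - tau i = a (i + 1) *: edge1 tau i + a (i - 1) *: edge2 tau i.
Proof.
rewrite (sum_ord3 _ i) (sum_ord3 (fun j => a j *: tau j) i) /edge1 /edge2 => a1.
have -> : a i = 1 - a (i + 1) - a (i - 1) by rewrite -a1; ring.
by apply/rowP => l; rewrite !mxE; ring.
Qed.

Lemma edges_free tau i s t : triangle tau ->
  s *: edge1 tau i + t *: edge2 tau i = 0 -> s = 0 /\ t = 0.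
Proof.
move=> tri st0; have [i1 i2 i3] := ord3_neq i.
pose a j := if j == i then - s - t else if j == i + 1 then s else t.
have ai : a i = - s - t by rewrite /a eqxx.
have a1 : a (i + 1) = s by rewrite /a (negbTE i1) eqxx.
have a2 : a (i - 1) = t by rewrite /a (negbTE i2) (negbTE i3).
have a_eq0 : forall j, a j = 0.
  apply: tri; rewrite (sum_ord3 _ i) ai a1 a2; first by ring.
  by rewrite -[RHS]st0; apply/rowP => l; rewrite !mxE; ring.
by rewrite -a1 -[X in _ /\ X = _]a2 !a_eq0.
Qed.

Lemma dim_edge_span tau i : triangle tau -> \dim (edge_span tau i) = 2.
Proof.
move=> tri.
have e1 : edge1 tau i != 0.
  apply/eqP => e0; have := @edges_free tau i 1 0 tri.
  by rewrite e0 scaler0 scale0r addr0 => /(_ erefl)[/eqP]; rewrite oner_eq0.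
have e2 : edge2 tau i != 0.
  apply/eqP => e0; have := @edges_free tau i 0 1 tri.
  by rewrite e0 scaler0 scale0r addr0 => /(_ erefl)[_ /eqP]; rewrite oner_eq0.
rewrite dimv_disjoint_sum ?dim_vline ?e1 ?e2 //.
apply/eqP; rewrite -subv0; apply/subvP => x.
rewrite memv_cap memv0 => /andP[/vlineP[s ->] /vlineP[t st]].
have := @edges_free tau i s (- t) tri.
rewrite scaleNr st subrr => /(_ erefl)[_ /eqP].
by rewrite oppr_eq0 => /eqP->; rewrite scale0r.
Qed.

Lemma aff_hull_vflat tau i : aff_hull tau = vflat (tau i) (edge_span tau i).
Proof.
apply/seteqP; split=> [_ [a /= a1 <-]|x /edge_spanP[s [t xE]]].
  by apply/edge_spanP; exists (a (i + 1)), (a (i - 1)); rewrite bary_ord3.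
have [i1 i2 i3] := ord3_neq i.
pose a j := if j == i then 1 - s - t else if j == i + 1 then s else t.
have ai : a i = 1 - s - t by rewrite /a eqxx.
have a1 : a (i + 1) = s by rewrite /a (negbTE i1) eqxx.
have a2 : a (i - 1) = t by rewrite /a (negbTE i2) (negbTE i3).
have sum1 : \sum_j a j = 1 by rewrite (sum_ord3 _ i) ai a1 a2; ring.
exists a => //; apply: (addIr (- tau i)).
by rewrite (bary_ord3 tau i sum1) a1 a2 xE.
Qed.

(** The perpendicular bisector as a linear equation, which makes [equidistant_flat] an affine
    subspace. *)
Lemma eucdist_eqP x v u :
  eucdist x (v + u) = eucdist x v <-> 2 * dotv (x - v) u = dotv u u.
Proof.
have E : dotv (x - (v + u)) (x - (v + u)) =
    dotv (x - v) (x - v) - 2 * dotv (x - v) u + dotv u u.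
  rewrite opprD addrA; move: (x - v) => z.
  by rewrite !dotvE (dotvC u z); ring.
rewrite /eucdist; split=> [e|e].
  by move: (congr1 (fun r => r ^+ 2) e); rewrite !sqr_enorm E; lra.
by rewrite /enorm E e subrK.
Qed.

Lemma equidistantP tau i x : equidistant_flat tau x <->
  2 * dotv (x - tau i) (edge1 tau i) = dotv (edge1 tau i) (edge1 tau i) /\
  2 * dotv (x - tau i) (edge2 tau i) = dotv (edge2 tau i) (edge2 tau i).
Proof.
have t1 : tau (i + 1) = tau i + edge1 tau i by rewrite [RHS]addrC subrK.
have t2 : tau (i - 1) = tau i + edge2 tau i by rewrite [RHS]addrC subrK.
split=> [h|[/eucdist_eqP h1 /eucdist_eqP h2]].
  by split; apply/eucdist_eqP; rewrite -?t1 -?t2; apply: h.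
rewrite -t1 in h1; rewrite -t2 in h2.
have h j : eucdist x (tau j) = eucdist x (tau i).
  by case: (ord3_cases i j) => ->.
by move=> j l; rewrite !h.
Qed.

Lemma equidistant_vflat tau i c : equidistant_flat tau c ->
  equidistant_flat tau = vflat c (orthov (edge_span tau i)).
Proof.
move=> /(equidistantP _ i)[c1 c2]; apply/seteqP; split=> x.
  move=> /(equidistantP _ i)[x1 x2]; apply/mem_orthovP => _ /edge_spanP[s [t ->]].
  have -> : x - c = (x - tau i) - (c - tau i) by rewrite opprB addrA subrK.
  by rewrite dotvBl !dotvDr !dotvZr; nra.
move=> /mem_orthovP xc; apply/(equidistantP _ i).
have xE z : dotv (x - tau i) z = dotv (x - c) z + dotv (c - tau i) z.
  by rewrite -dotvDl addrA subrK.
rewrite !xE !xc ?add0r //; apply/edge_spanP.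
  by exists 0, 1; rewrite scale0r scale1r add0r.
by exists 1, 0; rewrite scale0r scale1r addr0.
Qed.

(** The vector used for [dotv_sqr_le] is now nonzero, because the edges are free and its coefficient
    [dotv w w] is positive. *)
Lemma gram_gt0 tau i : triangle tau ->
  dotv (edge1 tau i) (edge2 tau i) ^+ 2 <
  dotv (edge1 tau i) (edge1 tau i) * dotv (edge2 tau i) (edge2 tau i).
Proof.
move=> tri; set u := edge1 tau i; set w := edge2 tau i.
have w0 : 0 < dotv w w.
  rewrite dotv_gt0; apply/eqP => w0; have := @edges_free tau i 0 1 tri.
  by rewrite -/w w0 scaler0 scale0r addr0 => /(_ erefl)[_ /eqP]; rewrite oner_eq0.
have z0 : 0 < dotv (dotv w w *: u - dotv u w *: w) (dotv w w *: u - dotv u w *: w).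
  rewrite dotv_gt0; apply/eqP; rewrite -scaleNr => /(edges_free tri)[/eqP].
  by rewrite gt_eqF.
rewrite -(ltr_pM2l w0) -subr_gt0; move: z0; congr (0 < _).
move: (u) (w) => a b; by rewrite !dotvE (dotvC b a); ring.
Qed.

Lemma circumcenterP tau : triangle tau ->
  aff_hull tau (circumcenter tau) /\ equidistant_flat tau (circumcenter tau).
Proof.
move=> tri; apply: (@xgetPex _ 0 (aff_hull tau `&` equidistant_flat tau)).
pose i : 'I_3 := ord0; set v := tau i; set u := edge1 tau i; set w := edge2 tau i.
have gram := gram_gt0 i tri; rewrite -/u -/w in gram.
pose D := 2 * (dotv u u * dotv w w - dotv u w ^+ 2).
have D0 : D != 0 by rewrite mulf_neq0 // subr_eq0 gt_eqF.
(* Cramer's rule for the two bisector equations in the edge coordinates. *)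
pose a := (dotv u u * dotv w w - dotv w w * dotv u w) / D.
pose b := (dotv u u * dotv w w - dotv u u * dotv u w) / D.
exists (v + (a *: u + b *: w)).
have vE z : v + z - v = z by rewrite addrAC subrr add0r.
split.
  by rewrite (aff_hull_vflat tau i) /vflat /= -/v vE; apply/edge_spanP; exists a, b.
apply/(equidistantP tau i); rewrite -/v vE -/u -/w.
have D0' : dotv u u * dotv w w - dotv u w ^+ 2 != 0 by rewrite subr_eq0 gt_eqF.
rewrite !(dotvDl (a *: u)) !dotvZl (dotvC w u) /a /b /D.
by split; field.
Qed.

(** The square of [R = (product of the sides) / (4 area)]: the Gram determinant is four times the
    squared area, and the last factor is the squared third side. *)
Lemma circumradius_eq tau i u w : triangle tau ->
  edge1 tau i = u -> edge2 tau i = w ->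
  4 * circumradius tau ^+ 2 * (dotv u u * dotv w w - dotv u w ^+ 2) =
  dotv u u * dotv w w * (dotv u u + dotv w w - 2 * dotv u w).
Proof.
move=> tri uE wE; have [caff ceq] := circumcenterP tri.
rewrite /circumradius (ceq ord0 i).
rewrite (aff_hull_vflat tau i) in caff; move/edge_spanP: caff => [a [b cE]].
move/(equidistantP tau i): ceq => []; rewrite /eucdist sqr_enorm cE uE wE.
rewrite !dotvDl !dotvDr !dotvZl !dotvZr (dotvC w u).
move: (dotv u u) (dotv w w) (dotv u w) => A B g h1 h2.
have -> : a * (a * A) + a * (b * g) + (b * (a * g) + b * (b * B)) =
    (a * A + b * B) / 2.
  by rewrite -[in RHS]h1 -[in RHS]h2; field.
have hA : 2 * a * (A * B - g ^+ 2) = A * B - g * B.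
  have -> : A * B - g * B = B * (2 * (a * A + b * g)) - g * (2 * (a * g + b * B)).
    by rewrite h1 h2 (mulrC A).
  by ring.
have hB : 2 * b * (A * B - g ^+ 2) = A * B - g * A.
  have -> : A * B - g * A = A * (2 * (a * g + b * B)) - g * (2 * (a * A + b * g)).
    by rewrite h1 h2.
  by ring.
have -> : 4 * ((a * A + b * B) / 2) * (A * B - g ^+ 2) =
    A * (2 * a * (A * B - g ^+ 2)) + B * (2 * b * (A * B - g ^+ 2)) by field.
by rewrite hA hB; ring.
Qed.

End TriangleGeometry.

(** * Normal components of vectors in the plane of the triangle *)

Section NormalBound.
Context {R : realType} {d : nat}.
Implicit Types (tau : 'I_3 -> 'rV[R]_d) (u w x n v : 'rV[R]_d) (S : set 'rV[R]_d)
  (T : {vspace 'rV[R]_d}) (e r : R).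

Definition angle_factor tau i : R := Num.max (cot (plane_angle tau i / 2)) 1.

(** [circle_form_le] is applied to the coordinates [s A], [t B] on the unit edges, with [c] the
    cosine of the plane angle. By [circumradius_eq] the squared third side is [4 R^2 (1 - c^2)], and
    [1 - c^2] cancels. *)
Lemma edge_span_normal_le tau i n r x : triangle tau -> 0 <= r ->
  `|dotv (edge1 tau i) n| <= r * (dotv (edge1 tau i) (edge1 tau i) / 2) ->
  `|dotv (edge2 tau i) n| <= r * (dotv (edge2 tau i) (edge2 tau i) / 2) ->
  x \in edge_span tau i ->
  `|dotv x n| <= r * circumradius tau * angle_factor tau i * enorm x.
Proof.
move=> tri r0 un wn /edge_spanP[s [t xE]].
have gram := gram_gt0 i tri.
have radE := circumradius_eq tri (erefl (edge1 tau i)) (erefl (edge2 tau i)).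
rewrite /angle_factor /plane_angle /vangle -/(edge1 tau i) -/(edge2 tau i).
move: (edge1 tau i) (edge2 tau i) xE un wn gram radE => u w xE un wn gram radE.
have u0 : 0 < dotv u u.
  rewrite lt_def dotv_ge0 andbT; apply: contraTneq gram => ->.
  by rewrite mul0r -leNgt sqr_ge0.
have w0 : 0 < dotv w w.
  rewrite lt_def dotv_ge0 andbT; apply: contraTneq gram => ->.
  by rewrite mulr0 -leNgt sqr_ge0.
set A := enorm u; set B := enorm w.
have A0 : 0 < A by rewrite enorm_gt0 -dotv_gt0.
have B0 : 0 < B by rewrite enorm_gt0 -dotv_gt0.
have AB0 := mulr_gt0 A0 B0.
set c := dotv u w / (A * B).
have gE : dotv u w = A * B * c by rewrite /c mulrC divfK ?gt_eqF.
have uE : dotv u u = A ^+ 2 by rewrite sqr_enorm.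
have wE : dotv w w = B ^+ 2 by rewrite sqr_enorm.
rewrite uE wE gE in radE gram un wn.
have c2 : c ^+ 2 < 1.
  rewrite -(ltr_pM2l (exprn_gt0 2 AB0)); move: gram.
  by rewrite !exprMn mulr1.
have /andP[cm1 c1] : -1 < c < 1.
  rewrite -ltr_norml.
  by rewrite -(@ltr_pXn2r _ 2) ?nnegrE ?real_normK ?num_real ?expr1n.
set K := Num.max _ 1.
have Kc : 1 + c <= K ^+ 2 * (1 - c) := cot_half_acos cm1 c1.
have K1 : 1 <= K by rewrite le_max lexx orbT.
have K21 : 1 <= K ^+ 2 by rewrite expr_ge1 // (le_trans _ K1).
have main := circle_form_le (s * A) (t * B) A0 B0 cm1 c1 K21 Kc.
have xx : dotv x x = (s * A) ^+ 2 + (t * B) ^+ 2 + 2 * (s * A) * (t * B) * c.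
  rewrite xE !dotvDl !dotvDr !dotvZl !dotvZr (dotvC w u) uE wE gE; ring.
have rad0 : 0 <= circumradius tau by exact: enorm_ge0.
have rad2 : 4 * circumradius tau ^+ 2 * (1 - c ^+ 2) =
    A ^+ 2 + B ^+ 2 - 2 * A * B * c.
  apply: (mulfI (lt0r_neq0 (exprn_gt0 2 AB0))).
  by move: radE; rewrite !exprMn => radE; rewrite -[RHS]mulrA; lra.
have sum_le : `|s * A| * A + `|t * B| * B <= 2 * circumradius tau * K * enorm x.
  rewrite -ler_sqr ?nnegrE ?addr_ge0 ?mulr_ge0 ?enorm_ge0 ?(ltW A0) ?(ltW B0) //.
    rewrite -(@ler_pM2l _ (1 - c ^+ 2)) ?subr_gt0 //.
    apply: (le_trans main); rewrite -rad2 -xx -sqr_enorm le_eqVlt.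
    by apply/orP; left; apply/eqP; ring.
  by rewrite (le_trans _ K1).
have xn : `|dotv x n| <= r / 2 * (`|s * A| * A + `|t * B| * B).
  rewrite xE dotvDl !dotvZl (le_trans (ler_normD _ _)) // !normrM mulrDr.
  rewrite (gtr0_norm A0) (gtr0_norm B0).
  have := normr_ge0 s; have := normr_ge0 t => t0 s0.
  have := ler_wpM2l s0 un; have := ler_wpM2l t0 wn; lra.
apply: (le_trans xn).
apply: (@le_trans _ _ (r / 2 * (2 * circumradius tau * K * enorm x))).
  by rewrite ler_wpM2l // divr_ge0.
by rewrite le_eqVlt; apply/orP; left; apply/eqP; field.
Qed.

Lemma normal_flat_vflat S v T : tangent_vec S v = [set u | u \in T] ->
  normal_flat S v = vflat v (orthov T).
Proof.
move=> tE; rewrite /normal_flat tE; apply/seteqP; split=> x /=.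
  by move=> h; apply/mem_orthovP.
by move/mem_orthovP.
Qed.

Lemma tangent_flat_vflat S v T : tangent_vec S v = [set u | u \in T] ->
  tangent_flat S v = vflat v T.
Proof.
move=> tE; rewrite /tangent_flat tE; apply/seteqP; split=> [_ [u uT <-]|x xT].
  by rewrite /vflat /= addrAC subrr add0r.
by exists (x - v) => //; rewrite addrC subrK.
Qed.

(** The residual has length [<x, n>] for its own unit direction [n], which is normal. The empty
    balls along [n] and [- n] bound [|<u, n>|] by [|u|^2 / (2 e)] for both edges [u], so
    [r = 1 / e]. *)
Lemma oproj_residual_le S tau i T e x : compact S -> triangle tau ->
  (forall j, S (tau j)) -> tangent_vec S (tau i) = [set u | u \in T] ->
  (forall n, n \in orthov T -> flat_along S (tau i) n) ->
  0 < e -> (e%:E <= ebs S (tau i))%E -> x \in edge_span tau i ->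
  enorm (x - oproj T x) <= circumradius tau / e * angle_factor tau i * enorm x.
Proof.
move=> cS tri vS tE flat e0 e_ebs xP; set z := x - oproj T x.
have zO : z \in orthov T by case: (oprojP T x).
have [->|z0] := eqVneq z 0.
  rewrite enorm0 !mulr_ge0 ?invr_ge0 ?enorm_ge0 ?(ltW e0) //.
  by rewrite le_max ler01 orbT.
have ez : 0 < enorm z by rewrite enorm_gt0.
pose n := (enorm z)^-1 *: z.
have nO : n \in orthov T by rewrite rpredZ.
have n1 : dotv n n = 1.
  by rewrite /n dotvZl dotvZr -sqr_enorm; field; rewrite gt_eqF.
have touch m j : m \in orthov T -> dotv m m = 1 ->
    2 * e * dotv (tau j - tau i) m <= dotv (tau j - tau i) (tau j - tau i).
  move=> mO m1.
  apply: (ebs_dotv_le cS (vS i) m1 (flat m mO) _ (ltW e0) e_ebs (vS j)).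
  by rewrite (normal_flat_vflat tE) /vflat /= addrAC subrr add0r.
have touch_norm j : `|dotv (tau j - tau i) n| <=
    e^-1 * (dotv (tau j - tau i) (tau j - tau i) / 2).
  have nN1 : dotv (- n) (- n) = 1 by rewrite dotvNl dotvNr opprK.
  have nNO : - n \in orthov T by rewrite rpredN.
  have t1 := touch n j nO n1; have t2 := touch (- n) j nNO nN1.
  rewrite dotvNr mulrN in t2.
  have e2 : 0 < 2 * e by rewrite mulr_gt0.
  rewrite [leRHS](_ : _ = dotv (tau j - tau i) (tau j - tau i) / (2 * e)).
    rewrite ler_norml lerNl !ler_pdivlMr // mulNr ![_ * (2 * e)]mulrC.
    by rewrite t1 andbT.
  by field; rewrite gt_eqF.
have xn : dotv x n = enorm z.
  have -> : dotv x n = (enorm z)^-1 * dotv x z by rewrite dotvZr.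
  have -> : dotv x z = enorm z ^+ 2.
    rewrite sqr_enorm /z [in RHS]dotvBl.
    move/mem_orthovP: zO => /(_ _ (oproj_mem T x)).
    by rewrite dotvC => ->; rewrite subr0.
  by field; rewrite gt_eqF.
have := edge_span_normal_le tri (_ : 0 <= e^-1) (touch_norm _) (touch_norm _) xP.
rewrite xn ger0_norm ?enorm_ge0 // => h; apply: (le_trans (h _)).
  by rewrite invr_ge0 ltW.
by rewrite (mulrC e^-1).
Qed.

End NormalBound.

(** * From the normal component to the angle bound *)

Lemma tangent_flat_along {R : realType} {d : nat} (S : set 'rV[R]_d)
    (v : 'rV[R]_d) (T : {vspace 'rV[R]_d}) :
  (forall e : R, 0 < e -> exists2 h, 0 < h & forall q, S q ->
    enorm (q - v) < h ->
    exists2 u, u \in T & enorm (q - v - u) <= e * enorm (q - v)) ->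
  forall n, n \in orthov T -> flat_along S v n.
Proof.
move=> approx n nO k k0.
(* The added [1] covers [n = 0]. *)
have n1 : 0 < enorm n + 1 by rewrite ltr_wpDl ?enorm_ge0.
have [h h0 hP] := approx (k / (enorm n + 1)) (divr_gt0 k0 n1).
exists h => // q Sq /(hP q Sq)[u uT qu].
have -> : dotv (q - v) n = dotv (q - v - u) n.
  by rewrite [RHS]dotvBl (dotvC u); have /mem_orthovP -> := nO; rewrite ?subr0.
apply: (le_trans (dotv_norm_le _ _)).
apply: (@le_trans _ _ (k / (enorm n + 1) * enorm (q - v) * (enorm n + 1))).
  by apply: ler_pM; rewrite ?enorm_ge0 // lerDl.
by rewrite mulrAC divfK ?gt_eqF.
Qed.

(** By Pythagoras the residual bound is the projection bound of [maxmin_angleP] with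
    [s = sqrt (1 - a^2)]. *)
Lemma flat_angle_le_asin {R : realType} {d : nat} (p q : 'rV[R]_d)
    (U V : {vspace 'rV[R]_d}) (a : R) :
  U != 0%VS -> (\dim U <= \dim V)%N -> 0 <= a <= 1 ->
  (forall x, x \in U -> enorm (x - oproj V x) <= a * enorm x) ->
  flat_angle (vflat p U) (vflat q V) <= asin a.
Proof.
move=> U0 dimUV aI res; rewrite /flat_angle !flat_dim_vflat dimUV -acos_sqrt //.
have V0 : V != 0%VS by rewrite -dimv_eq0 -lt0n (leq_trans _ dimUV) // lt0n dimv_eq0.
case/andP: aI => a0 a1.
have a2 : 0 <= 1 - a ^+ 2 by rewrite subr_ge0 expr_le1.
apply/maxmin_angleP => //.
  by rewrite sqrtr_ge0 -[leRHS]sqrtr1 ler_sqrt // lerBlDr lerDl sqr_ge0.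
move=> x xU; rewrite -ler_sqr ?nnegrE ?mulr_ge0 ?sqrtr_ge0 ?enorm_ge0 //.
rewrite exprMn sqr_sqrtr // !sqr_enorm.
have pyth := pythagoras V x.
have resx : enorm (x - oproj V x) ^+ 2 <= (a * enorm x) ^+ 2.
  by rewrite ler_sqr ?nnegrE ?mulr_ge0 ?enorm_ge0 // res.
by rewrite exprMn !sqr_enorm in resx; lra.
Qed.

(** Rules out [ebs = 0] in the theorem: a positive numerator makes the argument of the arcsine
    infinite. *)
Lemma circumradius_gt0 {R : realType} {d : nat} (tau : 'I_3 -> 'rV[R]_d) :
  triangle tau -> 0 < circumradius tau.
Proof.
move=> tri.
have radE := circumradius_eq tri (erefl (edge1 tau 0)) (erefl (edge2 tau 0)).
have gram := gram_gt0 0 tri.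
have norms : 2 * dotv (edge1 tau 0) (edge2 tau 0) <
    dotv (edge1 tau 0) (edge1 tau 0) + dotv (edge2 tau 0) (edge2 tau 0).
  have : 0 < dotv (edge1 tau 0 - edge2 tau 0) (edge1 tau 0 - edge2 tau 0).
    rewrite dotv_gt0; apply/eqP => e0.
    have := @edges_free _ _ tau 0 1 (-1) tri.
    rewrite scaleN1r scale1r e0 => /(_ erefl)[/eqP].
    by rewrite oner_eq0.
  move: (edge1 tau 0) (edge2 tau 0) => u w.
  by rewrite !dotvE (dotvC w u); lra.
have [rad0|rad0] := eqVneq (circumradius tau) 0; last first.
  by rewrite lt_def rad0 enorm_ge0.
have sq := sqr_ge0 (dotv (edge1 tau 0) (edge2 tau 0)).
rewrite -subr_gt0 in norms.
move: (mulr_gt0 (le_lt_trans sq gram) norms).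
by rewrite -radE rad0 expr0n /= mulr0 mul0r ltxx.
Qed.

Theorem lemma4 (R : realType) (k d : nat) (hk : (2 <= k)%N) (hkd : (k < d)%N)
    (Sigma : set 'rV[R]_d)
    (hcompact : compact Sigma) (hsmooth : smooth_submanifold k Sigma)
    (tau : 'I_3 -> 'rV[R]_d) (htri : triangle tau)
    (hvert : forall j : 'I_3, Sigma (tau j)) (i : 'I_3) :
  flat_angle (equidistant_flat tau) (normal_flat Sigma (tau i)) =
    flat_angle (aff_hull tau) (tangent_flat Sigma (tau i)) /\
  ((arcsin_arg Sigma tau i <= 1)%E ->
   flat_angle (aff_hull tau) (tangent_flat Sigma (tau i)) <=
     asin (fine (arcsin_arg Sigma tau i))).
Proof.
have [T [dimT tE approx]] := tangent_space (ltnW hkd) hsmooth (hvert i).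
have flat := tangent_flat_along approx.
have dimP := dim_edge_span i htri.
have nz (V : {vspace 'rV[R]_d}) : (0 < \dim V)%N -> V != 0%VS.
  by rewrite lt0n dimv_eq0.
have dimPT : (\dim (edge_span tau i) <= \dim T)%N by rewrite dimP dimT.
have P0 : edge_span tau i != 0%VS by rewrite nz // dimP.
rewrite (aff_hull_vflat tau i) (tangent_flat_vflat tE).
split.
  rewrite (normal_flat_vflat tE) (equidistant_vflat i (circumcenterP htri).2).
  (* [2 <= k < d] makes both complements nonzero. *)
  apply: flat_angle_orthov => //; apply: nz;
    rewrite ?dim_orthov ?dimT ?dimP ?subn_gt0 //.
    by rewrite (leq_trans _ hk).
  exact: leq_ltn_trans hk hkd.
have ebs0 : (0 <= ebs Sigma (tau i))%E.
  by apply: le_ereal_inf_tmp => _ [m _ <-]; rewrite lee_fin enorm_ge0.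
have res e x := @oproj_residual_le _ _ _ tau i T e x hcompact htri hvert tE flat.
have rad0 := circumradius_gt0 htri.
have K0 : 0 < angle_factor tau i by rewrite lt_max ltr01 orbT.
rewrite /arcsin_arg -/(angle_factor tau i).
(* For infinite [ebs] the argument is [0], while the residual bound holds for every finite [e > 0].
   The choice [e = (b + 1) / h] makes it at most [h], for arbitrary [h > 0]. *)
move: ebs0 res; case: (ebs Sigma (tau i)) => [e| |] //; last first.
  move=> _ res _; rewrite invey mule0 mul0e /=.
  apply: flat_angle_le_asin; rewrite ?lexx ?ler01 // => x xP.
  rewrite mul0r; apply/ler_addgt0Pl => h h0; rewrite addr0.
  pose b := circumradius tau * angle_factor tau i * enorm x.
  have b0 : 0 <= b by rewrite !mulr_ge0 ?enorm_ge0 // ltW.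
  have e0 : 0 < (b + 1) / h by rewrite divr_gt0 // ltr_wpDl.
  apply: (le_trans (res _ x e0 (leey _) xP)).
  have -> : circumradius tau / ((b + 1) / h) * angle_factor tau i * enorm x =
      h * (b / (b + 1)).
    rewrite /b; field; rewrite !gt_eqF //=.
    by rewrite -/b ltr_wpDl.
  rewrite ler_piMr //; first exact: ltW.
  by rewrite ler_pdivrMr ?ltr_wpDl // mul1r lerDl.
(* For [ebs = 0] the argument is [+oo], against the assumption that it is at most [1]. *)
rewrite lee_fin inver => e_ge0; have [->|e_neq0] := eqVneq e 0.
  by rewrite gt0_muley ?lte_fin // gt0_mulye ?lte_fin // leye_eq.
have e0 : 0 < e by rewrite lt_def e_neq0.
move=> res; rewrite -!EFinM lee_fin /= => arg1.
apply: flat_angle_le_asin => //.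
  by rewrite arg1 andbT !mulr_ge0 ?invr_ge0 // ltW.
by move=> x xP; apply: res.
Qed.
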